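(* Let $n,m,r\ge 1$ and $k\ge 2$ be integers, let $A\in\mathbb{R}^{n\times n}$, $B\in\mathbb{R}^{n\times m}$, $C\in\mathbb{R}^{r\times n}$, $D\in\mathbb{R}^{r\times m}$, and consider the system $x_{t+1}=Ax_t+Bu_t+w_t$, $y_t=Cx_t+Du_t$, $t=0,1,\dots$, with random initial state $x_0\in\mathbb{R}^n$, random control inputs $u_t\in\mathbb{R}^m$ and random attacks $w_t\in\mathbb{R}^n$. Let $G^*=[D~~CB~~CAB~~\cdots~~CA^{k-2}B]\in\mathbb{R}^{r\times mk}$ and $\mathbf{U}_t^{(k)}=[u_t^T~u_{t-1}^T~\cdots~u_{t-k+1}^T]^T\in\mathbb{R}^{mk}$, and let $\mathcal{F}_t=\sigma(x_0,w_0,\dots,w_{t-1})$. Assume: (i) there are $\psi>0$ and $0\le\rho<1$ with $\|A^t\|_2\le\psi\rho^t$ for all $t\ge0$; (ii) there is $\eta>0$ such that $\|x_0\|_{\psi_2}\le\eta$ and, conditionally on $\mathcal{F}_t$, $\|w_t\|_{\psi_2}\le\eta$ for all $t\ge0$; (iii) for some $0\le p<\frac{1}{2(k-1)}$ there is a sequence $(\xi_t)_{t\ge0}$ of independent $\mathrm{Bernoulli}(p)$ variables, with $\xi_t$ independent of $\mathcal{F}_t$ for each $t$, such that $\{\xi_t=0\}\subseteq\{w_t=0\}$ for all $t\ge0$; (iv) the control inputs $u_t$ are independent with $u_t\sim N(0,\sigma^2I_m)$, $\sigma>0$; (v) $\|G^*\|_F\le R$ for a given $R>0$. Let $q=1-(1-p)^{k-1}$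 and $\nu=\frac{\|C\|_2}{1-2q}\left(\frac{\eta}{\sigma}+\sqrt{m}\,\|B\|_2\right)$. Let $\beta>\frac{\sqrt{2\pi}R}{(1-2q)\sigma}$, let $\bar G=\{G\in\mathbb{R}^{r\times mk}:\|G\|_F\le R\}$, and let $G^{(t)}$, $t\in\{0,k,2k,\dots\}$, be generated by the stochastic projected subgradient method: $G^{(0)}=0$ and, for $t=0,k,2k,\dots$, with $f_t(G)=\|y_{t+k-1}-G\,\mathbf{U}_{t+k-1}^{(k)}\|_2$, $$g^{(t)}\in\partial f_t(G^{(t)}),\qquad \gamma_t=\frac{k\beta}{t+k},\qquad G^{(t+k)}=\Pi_{\bar G}\big(G^{(t)}-\gamma_tg^{(t)}\big).$$ Let $$E=\max\left\{\|G^{(0)}-G^*\|_F^2,\ \frac{\beta^2\sigma^2mk}{\beta(1-2q)\sigma/(\sqrt{2\pi}R)-1}\right\}.$$ Then there is a constant $K>0$ (depending at most on $\psi$) such that for all $t\ge0$ that are multiples of $k$, $$\mathbb{E}\big[\|G^{(t)}-G^*\|_F^2\big]\le K\left[\frac{\rho^{k-1}\nu}{1-\rho}\left(\frac{R\sqrt{mk}}{1-2q}+\frac{\rho^{k-1}\nu}{1-\rho}\right)+\frac{kE}{t+k}\right].$$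
   Context: $\|\cdot\|_2$ is the Euclidean norm of a vector or the spectral norm of a matrix; $\|\cdot\|_F$ is the Frobenius norm; $\partial f_t$ is the convex subdifferential (with respect to the Frobenius inner product); $\Pi_{\bar G}$ is the Frobenius-norm projection onto the convex set $\bar G$. For a scalar random variable $X$, $\|X\|_{\psi_2}=\inf\{s>0:\mathbb{E}[e^{X^2/s^2}]\le2\}$; for a random vector $X$, $\|X\|_{\psi_2}$ means $\|\,\|X\|_2\,\|_{\psi_2}$; ''$\|w_t\|_{\psi_2}\le\eta$ conditionally on $\mathcal{F}_t$'' means $\mathbb{E}[e^{\|w_t\|_2^2/\eta^2}\mid\mathcal{F}_t]\le2$ almost surely. Standing convention on the interplay of randomness: for every $t$, the future inputs $(u_s)_{s\ge t}$, the variables $(\xi_s)_{s\ge t}$ and the history $\sigma(x_0,w_0,\dots,w_{t-1},u_0,\dots,u_{t-1})$ are mutually independent. Apart from the stated assumptions, the attacks $w_t$ may be chosen arbitrarily by an adversary using historical information. The selection of $g^{(t)}$ is a measurable function of $G^{(t)}$, $y_{t+k-1}$, $\mathbf{U}_{t+k-1}^{(k)}$. *)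

(* Defs.v *)
From HB Require Import structures.
From mathcomp Require Import all_boot all_order all_algebra.
From mathcomp Require Import finmap.
From mathcomp Require Import all_classical all_reals all_analysis.
From mathcomp Require Import measurable_realfun.

Set Implicit Arguments.
Unset Strict Implicit.
Unset Printing Implicit Defensive.

Import Order.TTheory GRing.Theory Num.Theory.
Import numFieldNormedType.Exports.

Local Open Scope classical_set_scope.
Local Open Scope ring_scope.

(* The Borel sigma-algebra on matrices, generated by the entry maps. *)
Fact matrix_display : measure_display. Proof. exact: default_measure_display. Qed.

Section matrix_measurable.
Context {R : realType} {m n : nat}.

Definition matrix_measurable : set (set 'M[R]_(m, n)) :=
  <<s \bigcup_(ij in [set: 'I_m * 'I_n])
        preimage_set_system setT (fun M : 'M[R]_(m, n) => M ij.1 ij.2)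
          measurable >>.

Let matrix_measurable0 : matrix_measurable set0.
Proof. exact: sigma_algebra0. Qed.

Let matrix_measurableC (S : set 'M[R]_(m, n)) :
  matrix_measurable S -> matrix_measurable (~` S).
Proof. exact: sigma_algebraC. Qed.

Let matrix_measurable_bigcup (F : (set 'M[R]_(m, n))^nat) :
  (forall i, matrix_measurable (F i)) -> matrix_measurable (\bigcup_i F i).
Proof. exact: sigma_algebra_bigcup. Qed.

HB.instance Definition _ := @isMeasurable.Build matrix_display 'M[R]_(m, n)
  matrix_measurable matrix_measurable0 matrix_measurableC
  matrix_measurable_bigcup.

End matrix_measurable.

Section norms.
Context {R : realType}.

Definition norm2 n (v : 'cV[R]_n) : R := Num.sqrt (\sum_(i < n) v i 0 ^+ 2).

Definition spectral_norm m n (M : 'M[R]_(m, n)) : R :=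
  sup [set norm2 (M *m v) | v in [set v : 'cV[R]_n | norm2 v <= 1]].

Definition frob_inner m n (M N : 'M[R]_(m, n)) : R :=
  \sum_(i < m) \sum_(j < n) M i j * N i j.

Definition frob_norm m n (M : 'M[R]_(m, n)) : R := Num.sqrt (frob_inner M M).

Definition subdifferential m n (f : 'M[R]_(m, n) -> R) (G : 'M[R]_(m, n)) :
    set 'M[R]_(m, n) :=
  [set g | forall H, f G + frob_inner g (H - G) <= f H].

Definition is_frob_projection m n (S : set 'M[R]_(m, n)) (X Y : 'M[R]_(m, n)) :=
  S Y /\ forall Z, S Z -> frob_norm (X - Y) <= frob_norm (X - Z).

Definition frob_ball m n (rad : R) : set 'M[R]_(m, n) :=
  [set G | frob_norm G <= rad].

End norms.

Section system.
Context {R : realType} {n m r : nat}.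

Definition markov_param (A : 'M[R]_n) (B : 'M[R]_(n, m)) (C : 'M[R]_(r, n))
    (D : 'M[R]_(r, m)) (j : nat) : 'M[R]_(r, m) :=
  if j is i.+1 then C *m A ^+ i *m B else D.

(* The number of columns \sum_(j < k) m is m * k, in the form in which block
   matrices with k blocks of width m come in the library. *)
Definition markov_matrix k (A : 'M[R]_n) (B : 'M[R]_(n, m)) (C : 'M[R]_(r, n))
    (D : 'M[R]_(r, m)) : 'M[R]_(r, \sum_(j < k) m) :=
  \mxrow_(j < k) markov_param A B C D j.

(* Meaningful for k <= t.+1 only: t - j is a truncated subtraction. *)
Definition input_window (T : Type) k (u : nat -> T -> 'cV[R]_m) (t : nat)
    (om : T) : 'cV[R]_(\sum_(j < k) m) :=
  \mxcol_(j < k) u (t - j)%N om.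

End system.

Section probability_notions.
Context {d : measure_display} {T : measurableType d} {R : realType}.
Variable P : probability T R.

Definition mutually_independent (I : choiceType) (F : I -> set (set T)) :=
  forall (J : {fset I}) (E : I -> set T),
    (forall i, i \in J -> F i (E i)) ->
    P (\bigcap_(i in [set` J]) E i) = (\prod_(i <- J) P (E i))%E.

(* N(0, sigma^2 I_m), i.e. the m-fold product of N(0, sigma^2); the second
   argument of normal_prob is the standard deviation. *)
Definition isotropic_gaussian m (sigma : R) (X : {RV P >-> 'cV[R]_m}) :=
  forall S : 'I_m -> set R, (forall i, measurable (S i)) ->
    distribution P X [set v | forall i, S i (v i 0)] =
    (\prod_(i < m) normal_prob 0 sigma (S i))%E.

Definition psi2_norm (X : T -> R) : \bar R :=
  ereal_inf [set s%:E | s in [set s : R | 0 < s /\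
    (\int[P]_om (expR (X om ^+ 2 / s ^+ 2))%:E <= 2%:E)%E]].

(* Z is a version of E[X | F], for X >= 0 and a sub-sigma-algebra F. *)
Definition is_cond_expectation (F : set (set T)) (X Z : T -> \bar R) :=
  [/\ g_sigma_algebra_preimage Z `<=` F,
      (forall om, 0 <= Z om)%E &
      forall S, F S -> (\int[P]_(om in S) Z om = \int[P]_(om in S) X om)%E].

Definition cond_psi2_le n (F : set (set T)) (X : T -> 'cV[R]_n) (eta : R) :=
  exists2 Z : T -> \bar R,
    is_cond_expectation F (fun om => (expR (norm2 (X om) ^+ 2 / eta ^+ 2))%:E) Z
    & {ae P, forall om, (Z om <= 2%:E)%E}.

End probability_notions.

Section filtrations.
Context {d : measure_display} {T : measurableType d}.
Context {d' : measure_display} {S : measurableType d'}.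
Context {d1 : measure_display} {S1 : measurableType d1}.

(* sigma(X_s : s >= t) *)
Definition sigma_future (X : nat -> T -> S) (t : nat) : set (set T) :=
  <<s \bigcup_(s in [set s | (t <= s)%N]) g_sigma_algebra_preimage (X s) >>.

(* sigma(x0, w_0, ..., w_(t-1)) *)
Definition sigma_attack (x0 : T -> S) (w : nat -> T -> S) (t : nat) :
    set (set T) :=
  <<s g_sigma_algebra_preimage x0 `|`
      \bigcup_(s in `I_t) g_sigma_algebra_preimage (w s) >>.

(* sigma(x0, w_0, ..., w_(t-1), u_0, ..., u_(t-1)) *)
Definition sigma_history (x0 : T -> S) (w : nat -> T -> S) (u : nat -> T -> S1)
    (t : nat) : set (set T) :=
  <<s g_sigma_algebra_preimage x0 `|`
      \bigcup_(s in `I_t) (g_sigma_algebra_preimage (w s) `|`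
                           g_sigma_algebra_preimage (u s)) >>.

End filtrations.

(* Main.v *)
(** Write [D = G^(t) - Gstar], [s = t + k - 1] and let the attack-free event be
    [xi_t = ... = xi_(t+k-2) = 0], of probability [1 - q]. Then
    [y_s - Gstar U_s = z + v] with [z = C A^(k-1) x_t] and [v = 0] on the
    attack-free event, so the excess loss [f_t(G^(t)) - f_t(Gstar)] is at least
    [|D U_s| - 2|z|] there and at least [- |D U_s|] elsewhere. History, future
    inputs and future [xi] are independent, hence the expected excess loss is at
    least [(1 - 2q) E|D U_s| - 2 E|z|], where
    [E|D U_s| >= sigma / sqrt (2 pi) E|D|_F >= sigma / (2 rad sqrt (2 pi)) E|D|_F^2].
    With [a_j = E|D|_F^2] at [t = j k] and
    [c = beta (1 - 2q) sigma / (sqrt (2 pi) rad) > 1] the projected subgradient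
    inequality becomes
    [a_(j+1) <= (1 - c/(j+1)) a_j + 4 beta/(j+1) E|z| + beta^2 sigma^2 m k/(j+1)^2],
    whose solutions are at most [4 beta E|z| / c + E0/(j+1)], where [E0] is the
    maximum called [E] in the theorem.

    The sharp constant in [E|D U_s| >= sigma sqrt (2/pi) E|D|_F] would give [2c]
    in place of [c]. A factor 1/2 can therefore be lost, and it is spent on
    replacing the rotation invariance of the Gaussian law by its invariance under
    sign changes of the coordinates together with a Khintchine inequality. *)

Require Import Defs.
From HB Require Import structures.
From mathcomp Require Import all_boot all_order all_algebra.
From mathcomp Require Import finmap.
From mathcomp Require Import all_classical all_reals all_analysis.
From mathcomp Require Import measurable_realfun.
From mathcomp Require Import ring lra.

Set Implicit Arguments.
Unset Strict Implicit.
Unset Printing Implicit Defensive.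

Import Order.TTheory GRing.Theory Num.Theory.
Import numFieldNormedType.Exports.

Local Open Scope classical_set_scope.
Local Open Scope ring_scope.

(** * Frobenius and spectral norms *)

Section frobenius.
Context {R : realType}.
Implicit Types m n : nat.

Lemma frob_innerC m n (M N : 'M[R]_(m, n)) : frob_inner M N = frob_inner N M.
Proof. by apply: eq_bigr => i _; apply: eq_bigr => j _; rewrite mulrC. Qed.

Lemma frob_innerDl m n (M N L : 'M[R]_(m, n)) :
  frob_inner (M + N) L = frob_inner M L + frob_inner N L.
Proof.
rewrite /frob_inner -big_split; apply: eq_bigr => i _.
by rewrite -big_split; apply: eq_bigr => j _; rewrite mxE mulrDl.
Qed.

Lemma frob_innerZl m n a (M L : 'M[R]_(m, n)) :
  frob_inner (a *: M) L = a * frob_inner M L.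
Proof.
rewrite /frob_inner mulr_sumr; apply: eq_bigr => i _.
by rewrite mulr_sumr; apply: eq_bigr => j _; rewrite mxE mulrA.
Qed.

Lemma frob_innerNl m n (M L : 'M[R]_(m, n)) :
  frob_inner (- M) L = - frob_inner M L.
Proof. by rewrite -scaleN1r frob_innerZl mulN1r. Qed.

Lemma frob_innerDr m n (M N L : 'M[R]_(m, n)) :
  frob_inner L (M + N) = frob_inner L M + frob_inner L N.
Proof. by rewrite frob_innerC frob_innerDl !(frob_innerC L). Qed.

Lemma frob_innerZr m n a (M L : 'M[R]_(m, n)) :
  frob_inner L (a *: M) = a * frob_inner L M.
Proof. by rewrite frob_innerC frob_innerZl frob_innerC. Qed.

Lemma frob_innerNr m n (M L : 'M[R]_(m, n)) :
  frob_inner L (- M) = - frob_inner L M.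
Proof. by rewrite frob_innerC frob_innerNl frob_innerC. Qed.

Definition frob_innerE := (@frob_innerDl, @frob_innerDr, @frob_innerNl,
  @frob_innerNr, @frob_innerZl, @frob_innerZr).

Lemma frob_inner_ge0 m n (M : 'M[R]_(m, n)) : 0 <= frob_inner M M.
Proof. by apply: sumr_ge0 => i _; apply: sumr_ge0 => j _; exact: sqr_ge0. Qed.

Lemma frob_norm_ge0 m n (M : 'M[R]_(m, n)) : 0 <= frob_norm M.
Proof. exact: sqrtr_ge0. Qed.

Lemma frob_norm_sqr m n (M : 'M[R]_(m, n)) : frob_norm M ^+ 2 = frob_inner M M.
Proof. by rewrite sqr_sqrtr ?frob_inner_ge0. Qed.

Lemma frob_norm_eq0 m n (M : 'M[R]_(m, n)) : frob_norm M = 0 -> M = 0.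
Proof.
move=> M0; have : frob_inner M M == 0 by rewrite -frob_norm_sqr M0 expr0n.
rewrite psumr_eq0 => [|i _]; last by apply: sumr_ge0 => j _; exact: sqr_ge0.
move=> /allP M0'; apply/matrixP => i j; rewrite mxE.
move: (M0' i (mem_index_enum _)) => /=.
rewrite psumr_eq0 => [/allP/(_ j (mem_index_enum _))|k _]; last exact: sqr_ge0.
by rewrite /= mulf_eq0 orbb => /eqP.
Qed.

(** The square of [|N| M - |M| N] is expanded and divided by [2 |M| |N|]; the two degenerate cases
    come first. *)
Lemma frob_cauchy_schwarz m n (M N : 'M[R]_(m, n)) :
  frob_inner M N <= frob_norm M * frob_norm N.
Proof.
have [M0|M0] := eqVneq (frob_norm M) 0.
  by rewrite M0 (frob_norm_eq0 M0) -(scale0r 0) frob_innerZl !mul0r.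
have [N0|N0] := eqVneq (frob_norm N) 0.
  by rewrite N0 (frob_norm_eq0 N0) -(scale0r 0) frob_innerZr mul0r mulr0.
have a0 : 0 < frob_norm M by rewrite lt_neqAle eq_sym M0 frob_norm_ge0.
have b0 : 0 < frob_norm N by rewrite lt_neqAle eq_sym N0 frob_norm_ge0.
have := frob_inner_ge0 (frob_norm N *: M - frob_norm M *: N).
rewrite !frob_innerE -!frob_norm_sqr (frob_innerC N M) => H.
have ab0 : 0 < 2 * (frob_norm M * frob_norm N) by rewrite !mulr_gt0.
by rewrite -(ler_pM2l ab0); lra.
Qed.

Lemma frob_normD m n (M N : 'M[R]_(m, n)) :
  frob_norm (M + N) <= frob_norm M + frob_norm N.
Proof.
rewrite -[leRHS]ger0_norm ?addr_ge0 ?frob_norm_ge0// -sqrtr_sqr ler_sqrt ?sqr_ge0//.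
rewrite !frob_innerE sqrrD !frob_norm_sqr (frob_innerC N M).
by have := frob_cauchy_schwarz M N; lra.
Qed.

Lemma frob_normZ m n a (M : 'M[R]_(m, n)) : frob_norm (a *: M) = `|a| * frob_norm M.
Proof.
rewrite /frob_norm frob_innerZl frob_innerZr mulrA -expr2 sqrtrM ?sqr_ge0//.
by rewrite sqrtr_sqr.
Qed.

Lemma frob_normN m n (M : 'M[R]_(m, n)) : frob_norm (- M) = frob_norm M.
Proof. by rewrite -scaleN1r frob_normZ normrN1 mul1r. Qed.

Lemma frob_norm0 m n : frob_norm (0 : 'M[R]_(m, n)) = 0.
Proof. by rewrite -(scale0r 0) frob_normZ normr0 mul0r. Qed.

Lemma frob_normB m n (M N : 'M[R]_(m, n)) :
  frob_norm (M - N) <= frob_norm M + frob_norm N.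
Proof. by rewrite -(frob_normN N) frob_normD. Qed.

Lemma frob_norm_sum m n (I : Type) (s : seq I) (Q : pred I) (F : I -> 'M[R]_(m, n)) :
  frob_norm (\sum_(i <- s | Q i) F i) <= \sum_(i <- s | Q i) frob_norm (F i).
Proof.
elim/big_rec2: _ => [|i y z _ yz]; first by rewrite frob_norm0.
by apply: le_trans (frob_normD _ _) _; rewrite lerD2l.
Qed.

Lemma norm2E n (v : 'cV[R]_n) : norm2 v = frob_norm v.
Proof.
by congr Num.sqrt; apply: eq_bigr => i _; rewrite big_ord1 expr2.
Qed.

Lemma norm2_sqr n (v : 'cV[R]_n) : norm2 v ^+ 2 = \sum_i v i 0 ^+ 2.
Proof. by rewrite sqr_sqrtr// sumr_ge0// => i _; rewrite sqr_ge0. Qed.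

Lemma norm2_ge0 n (v : 'cV[R]_n) : 0 <= norm2 v.
Proof. exact: sqrtr_ge0. Qed.

Lemma norm2D n (v w : 'cV[R]_n) : norm2 (v + w) <= norm2 v + norm2 w.
Proof. by rewrite !norm2E frob_normD. Qed.

Lemma norm2B n (v w : 'cV[R]_n) : norm2 (v - w) <= norm2 v + norm2 w.
Proof. by rewrite !norm2E frob_normB. Qed.

Lemma norm2Z n a (v : 'cV[R]_n) : norm2 (a *: v) = `|a| * norm2 v.
Proof. by rewrite !norm2E frob_normZ. Qed.

Lemma norm2_0 n : norm2 (0 : 'cV[R]_n) = 0.
Proof. by rewrite norm2E frob_norm0. Qed.

(** The families become columns through an enumeration of [I], so that the Frobenius case
    applies. *)
Lemma cauchy_schwarz_sum (I : finType) (a b : I -> R) :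
  \sum_i a i * b i <= Num.sqrt (\sum_i a i ^+ 2) * Num.sqrt (\sum_i b i ^+ 2).
Proof.
have E (f g : I -> R) : \sum_i f i * g i =
    frob_inner (\col_(i < #|I|) f (enum_val i)) (\col_i g (enum_val i)).
  rewrite /frob_inner (reindex _ (onW_bij _ (@enum_val_bij I))).
  by apply: eq_bigr => i _; rewrite big_ord1 !mxE.
under [X in _ <= Num.sqrt X * _]eq_bigr do rewrite expr2.
under [X in _ <= _ * Num.sqrt X]eq_bigr do rewrite expr2.
by rewrite !E frob_cauchy_schwarz.
Qed.

(** Cauchy-Schwarz row by row. It also bounds the set whose supremum defines [spectral_norm]. *)
Lemma norm2_mulmx m n (M : 'M[R]_(m, n)) (v : 'cV[R]_n) :
  norm2 (M *m v) <= frob_norm M * norm2 v.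
Proof.
rewrite -[leRHS]ger0_norm ?mulr_ge0 ?frob_norm_ge0 ?norm2_ge0//.
rewrite -sqrtr_sqr ler_sqrt ?sqr_ge0// exprMn frob_norm_sqr norm2_sqr mulr_suml.
apply: ler_sum => i _; rewrite mxE.
under [X in _ <= X * _]eq_bigr do rewrite -expr2.
set a := \sum_j M i j * v j 0.
have A0 (f : 'I_n -> R) : 0 <= \sum_j f j ^+ 2 by apply: sumr_ge0 => j _; exact: sqr_ge0.
rewrite -(sqr_sqrtr (A0 (M i))) -(sqr_sqrtr (A0 (v^~ 0))) -exprMn.
rewrite -[leLHS]real_normK ?num_real// ler_sqr ?nnegrE ?mulr_ge0 ?sqrtr_ge0//.
rewrite ler_norml; apply/andP; split; last exact: cauchy_schwarz_sum.
rewrite lerNl -sumrN; under eq_bigr do rewrite -mulNr.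
apply: le_trans (cauchy_schwarz_sum _ _) _.
by under eq_bigr do rewrite sqrrN.
Qed.

Lemma spectral_normP m n (M : 'M[R]_(m, n)) (v : 'cV[R]_n) :
  norm2 (M *m v) <= spectral_norm M * norm2 v.
Proof.
have ub : has_ubound [set norm2 (M *m v) | v in [set v : 'cV[R]_n | norm2 v <= 1]].
  exists (frob_norm M) => _ [w /= w1 <-].
  by apply: le_trans (norm2_mulmx _ _) _; rewrite ler_piMr ?frob_norm_ge0.
have [v0|v0] := eqVneq (norm2 v) 0.
  have -> : v = 0 by apply: frob_norm_eq0; rewrite -norm2E.
  by rewrite mulmx0 !norm2_0 mulr0.
have vp : 0 < norm2 v by rewrite lt_neqAle eq_sym v0 norm2_ge0.
rewrite -ler_pdivrMr// mulrC -[X in X * _]gtr0_norm ?invr_gt0// -norm2Z.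
rewrite scalemxAr; apply: ub_le_sup => //; exists ((norm2 v)^-1 *: v) => //=.
by rewrite norm2Z gtr0_norm ?invr_gt0// mulVf.
Qed.

Lemma spectral_norm_ge0 m n (M : 'M[R]_(m, n)) : 0 <= spectral_norm M.
Proof.
apply: ub_le_sup; last by exists 0; rewrite /= ?mulmx0 ?norm2_0.
exists (frob_norm M) => _ [w /= w1 <-].
by apply: le_trans (norm2_mulmx _ _) _; rewrite ler_piMr ?frob_norm_ge0.
Qed.

End frobenius.

(** * Projection, subgradients and a Khintchine inequality *)

Section projection.
Context {R : realType} {m n : nat}.
Implicit Types X Y Z : 'M[R]_(m, n).

(** The radial formula for the projection; an explicit function is what later makes the iterates
    measurable. *)
Definition ball_proj (rad : R) X :=
  if frob_norm X <= rad then X else (rad / frob_norm X) *: X.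

Variable rad : R.
Hypothesis rad_ge0 : 0 <= rad.

Lemma ball_proj_le X : frob_norm (ball_proj rad X) <= rad.
Proof.
rewrite /ball_proj; case: (leP (frob_norm X) rad) => // radX.
have X0 : 0 < frob_norm X by exact: le_lt_trans rad_ge0 radX.
rewrite frob_normZ ger0_norm ?divr_ge0// ?frob_norm_ge0//.
by rewrite divfK// gt_eqF.
Qed.

(** The obtuse-angle property. Outside the ball, [X - ball_proj rad X] is a nonnegative multiple of
    [X], and Cauchy-Schwarz bounds [<X, Z>] by [rad |X|], the value of [<X, ball_proj rad X>]. *)
Lemma ball_proj_inner X Z : frob_norm Z <= rad ->
  frob_inner (X - ball_proj rad X) (Z - ball_proj rad X) <= 0.
Proof.
move=> Zrad; rewrite /ball_proj; case: (leP (frob_norm X) rad) => [_|radX].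
  by rewrite subrr -(scale0r 0) frob_innerZl mul0r.
have X0 : 0 < frob_norm X by exact: le_lt_trans rad_ge0 radX.
rewrite -{1}[X]scale1r -scalerBl frob_innerZl; apply: mulr_ge0_le0.
  by rewrite subr_ge0 ler_pdivrMr ?mul1r// ltW.
rewrite !frob_innerE -frob_norm_sqr expr2 mulrA divfK ?gt_eqF// subr_le0.
apply: le_trans (frob_cauchy_schwarz _ _) _.
by rewrite mulrC ler_wpM2r ?frob_norm_ge0.
Qed.

Lemma ball_proj_pythagoras X Z : frob_norm Z <= rad ->
  frob_norm (X - ball_proj rad X) ^+ 2 + frob_norm (ball_proj rad X - Z) ^+ 2
    <= frob_norm (X - Z) ^+ 2.
Proof.
move=> /(ball_proj_inner X); set Y := ball_proj rad X => H.
rewrite (_ : X - Z = (X - Y) - (Z - Y)); last by rewrite opprB addrA subrK.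
rewrite -(frob_normN (Y - Z)) opprB !frob_norm_sqr !(frob_innerDl (X - Y)).
rewrite !(frob_innerDr (X - Y)) !frob_innerNl !frob_innerNr (frob_innerC (Z - Y)).
by rewrite opprK; lra.
Qed.

(** Uniqueness of the projection: the Pythagorean inequality at [Z = Y] and the minimality of [Y]
    force the distance between the two points to vanish. *)
Lemma frob_projectionE X Y :
  is_frob_projection (frob_ball rad) X Y -> Y = ball_proj rad X.
Proof.
move=> [Yrad /(_ _ (ball_proj_le X)) minY]; apply/esym/eqP; rewrite -subr_eq0.
apply/eqP/frob_norm_eq0/eqP; rewrite -sqrf_eq0 eq_le sqr_ge0 andbT.

have := ball_proj_pythagoras X Yrad.
have : frob_norm (X - Y) ^+ 2 <= frob_norm (X - ball_proj rad X) ^+ 2.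
  by rewrite ler_sqr ?nnegrE ?frob_norm_ge0.
lra.
Qed.

End projection.

(** * Subgradients of the norm loss and one projected step *)

Section subgradient.
Context {R : realType} {r N : nat}.
Variables (y : 'cV[R]_r) (U : 'cV[R]_N).
Let f (H : 'M[R]_(r, N)) := norm2 (y - H *m U).

(** Testing the subgradient at [G + g] gives [|g|^2 <= f (G + g) - f G <= |g U| <= |g| |U|]. *)
Lemma subgradient_norm (G g : 'M[R]_(r, N)) :
  subdifferential f G g -> frob_norm g <= norm2 U.
Proof.
move=> /(_ (G + g)); rewrite (addrC G) addrK /f => H.
have [->|g0] := eqVneq (frob_norm g) 0; first exact: norm2_ge0.
have gp : 0 < frob_norm g by rewrite lt_neqAle eq_sym g0 frob_norm_ge0.
rewrite -(ler_pM2l gp) -expr2 frob_norm_sqr.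
apply: le_trans (norm2_mulmx g U); rewrite -(lerD2r (norm2 (y - G *m U))).
rewrite [leLHS]addrC; apply: le_trans H _; rewrite mulmxDl opprD addrA.
by rewrite addrAC [leRHS]addrC norm2B.
Qed.

(** Projecting does not increase the distance to [Gs]. In the expanded square the cross term is
    controlled by the subgradient inequality at [Gs], the last term by [subgradient_norm]. *)
Lemma projected_subgradient_step (rad gamma : R) (G g G' Gs : 'M[R]_(r, N)) :
  0 <= rad -> 0 <= gamma -> frob_norm Gs <= rad ->
  subdifferential f G g ->
  is_frob_projection (frob_ball rad) (G - gamma *: g) G' ->
  frob_norm (G' - Gs) ^+ 2 <=
    frob_norm (G - Gs) ^+ 2 - 2 * gamma * (f G - f Gs) + gamma ^+ 2 * norm2 U ^+ 2.
Proof.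
move=> rad0 gamma0 Gsrad dg /(frob_projectionE rad0) ->.
have := ball_proj_pythagoras rad0 (G - gamma *: g) Gsrad.
move=> /(le_trans _)H; apply: le_trans (H _ _) _; first by rewrite lerDr sqr_ge0.
rewrite addrAC frob_norm_sqr !(frob_innerDl (G - Gs)) !(frob_innerDr (G - Gs)).
rewrite !(frob_innerNl (_ *: _)) !(frob_innerNr (_ *: _)) !frob_innerZl !frob_innerZr.
rewrite (frob_innerC g) -!frob_norm_sqr.
have := dg Gs; rewrite -(opprB G Gs) frob_innerNr => Hs.
have gU : gamma ^+ 2 * frob_norm g ^+ 2 <= gamma ^+ 2 * norm2 U ^+ 2.
  rewrite ler_wpM2l ?sqr_ge0// ler_sqr ?nnegrE ?frob_norm_ge0 ?norm2_ge0//.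
  exact: subgradient_norm dg.
have {}Hs : gamma * (f G - f Gs) <= gamma * frob_inner (G - Gs) g.
  by rewrite ler_wpM2l// (frob_innerC _ g); lra.
rewrite [gamma ^+ 2]expr2 in gU *; lra.
Qed.

End subgradient.

Lemma mulmx_sum_col (R : comNzRingType) m n (M : 'M[R]_(m, n)) (v : 'cV[R]_n) :
  M *m v = \sum_j v j 0 *: col j M.
Proof.
apply/matrixP => i k; rewrite ord1 mxE summxE; apply: eq_bigr => j _.
by rewrite !mxE mulrC.
Qed.

(** * Averages over sign changes and the Khintchine inequality *)

Section khintchine.
Context {R : realType} {N : nat}.

Definition flip (j : 'I_N) (U : 'cV[R]_N) : 'cV[R]_N :=
  \col_i (if i == j then - U i 0 else U i 0).

(** For duplicate-free [l], the expectation of [h] when the coordinates in [l] receive independent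
    uniform signs. The iterated two-point mean lets inductions on [l] split off one sign. *)
Fixpoint sign_avg (l : seq 'I_N) (h : 'cV[R]_N -> R) (U : 'cV[R]_N) : R :=
  if l is j :: l' then (sign_avg l' h U + sign_avg l' h (flip j U)) / 2 else h U.

Lemma sign_avg_ge l (h h1 h2 : 'cV[R]_N -> R) (a b : R) U :
  (forall V, a * h1 V - b * h2 V <= h V) ->
  a * sign_avg l h1 U - b * sign_avg l h2 U <= sign_avg l h U.
Proof.
move=> H; elim: l U => [|j l IH] U /=; first exact: H.
by have := IH U; have := IH (flip j U); lra.
Qed.

Context {r : nat}.
Variable M : 'M[R]_(r, N).
(** When the signs in [l] are averaged, [rest] is the part of [M U] that stays deterministic and
    [var] the accumulated variance of the other part. *)
Let rest (l : seq 'I_N) (U : 'cV[R]_N) := \sum_(j | j \notin l) U j 0 *: col j M.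
Let var (l : seq 'I_N) (U : 'cV[R]_N) :=
  \sum_(j <- l) U j 0 ^+ 2 * norm2 (col j M) ^+ 2.

Let rest_cons j l U : j \notin l ->
  rest l U = rest (j :: l) U + U j 0 *: col j M.
Proof.
move=> jl; rewrite /rest (bigD1 j)//= addrC; congr (_ + _).
by apply: eq_bigl => i; rewrite inE negb_or andbC.
Qed.

Let rest_flip j l U : j \notin l ->
  rest l (flip j U) = rest (j :: l) U - U j 0 *: col j M.
Proof.
move=> jl; rewrite (rest_cons _ jl) mxE eqxx scaleNr; congr (_ - _).
apply: eq_bigr => i; rewrite inE negb_or => /andP[ij _].
by rewrite mxE (negbTE ij).
Qed.

Let var_flip j l U : var l (flip j U) = var l U.
Proof.
by apply: eq_bigr => i _; rewrite mxE; case: ifP => // _; rewrite sqrrN.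
Qed.

Let var_cons j l U : var (j :: l) U = norm2 (U j 0 *: col j M) ^+ 2 + var l U.
Proof. by rewrite /var big_cons norm2Z exprMn real_normK ?num_real. Qed.

Let var_ge0 l U : 0 <= var l U.
Proof. by apply: sumr_ge0 => j _; rewrite mulr_ge0// sqr_ge0. Qed.

Let norm2D_sqr (a b : 'cV[R]_r) :
  norm2 (a + b) ^+ 2 = norm2 a ^+ 2 + norm2 b ^+ 2 + 2 * frob_inner a b.
Proof. by rewrite !norm2E !frob_norm_sqr !frob_innerE (frob_innerC b); ring. Qed.

Let norm2B_sqr (a b : 'cV[R]_r) :
  norm2 (a - b) ^+ 2 = norm2 a ^+ 2 + norm2 b ^+ 2 - 2 * frob_inner a b.
Proof. by rewrite !norm2E !frob_norm_sqr !frob_innerE (frob_innerC b); ring. Qed.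

(** Each sign contributes through the parallelogram identity. *)
Let sqr_avg l U : uniq l ->
  sign_avg l (fun U => norm2 (M *m U) ^+ 2) U = norm2 (rest l U) ^+ 2 + var l U.
Proof.
elim: l U => [|j l IH] U /=.
  by move=> _; rewrite /var big_nil addr0 mulmx_sum_col /rest.
move=> /andP[jl ul]; rewrite !IH// var_flip (rest_flip _ jl) (rest_cons _ jl) var_cons.
by rewrite norm2D_sqr norm2B_sqr; field.
Qed.

(** The coefficients 6 and 3 are those of the fourth moment of a scalar Gaussian with nonzero mean;
    the induction adds one sign at a time. *)
Let pow4_avg l U : uniq l ->
  sign_avg l (fun U => norm2 (M *m U) ^+ 4) U <=
    norm2 (rest l U) ^+ 4 + 6 * norm2 (rest l U) ^+ 2 * var l U + 3 * var l U ^+ 2.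
Proof.
elim: l U => [|j l IH] U /=.
  by move=> _; rewrite /var big_nil expr0n !mulr0 !addr0 mulmx_sum_col /rest.
move=> /andP[jl ul]; have := IH U ul; have := IH (flip j U) ul.
rewrite var_flip (rest_flip _ jl) (rest_cons _ jl) var_cons !(exprM _ 2 2).
rewrite norm2B_sqr norm2D_sqr.
set a := rest _ _; set b := _ *: _; set V := var l U.
have ab : frob_inner a b ^+ 2 <= norm2 a ^+ 2 * norm2 b ^+ 2.
  rewrite -exprMn -[leLHS]real_normK ?num_real// ler_sqr ?nnegrE ?mulr_ge0 ?norm2_ge0//.
  rewrite !norm2E ler_norml frob_cauchy_schwarz//= andbT lerNl -frob_innerNl.
  by rewrite (le_trans (frob_cauchy_schwarz _ _))// frob_normN.
have a0 := sqr_ge0 (norm2 a); have b0 := sqr_ge0 (norm2 b).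
have V0 : 0 <= V := var_ge0 l U.
move: (norm2 a ^+ 2) (norm2 b ^+ 2) (frob_inner a b) a0 b0 ab V0 => A B c A0 B0 AB V0.
move: (sign_avg _ _ U) (sign_avg _ _ (flip j U)) => s1 s2 H1 H2.
(* Terms linear in [c] cancel in the mean of [H1] and [H2]; [4 c^2 <= 4 A B] then leaves [2 B^2] to
   spare. *)
have BB : 0 <= B ^+ 2 by exact: sqr_ge0.
nra.
Qed.

(* The pointwise bound [s >= 3/4 s^2 - 1/16 s^4] turns second and fourth
   moments into a lower bound on the first one. *)
Lemma khintchine (U : 'cV[R]_N) :
  1 / 2 * Num.sqrt (\sum_j U j 0 ^+ 2 * norm2 (col j M) ^+ 2) <=
    sign_avg (enum 'I_N) (fun U => norm2 (M *m U)) U.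
Proof.
have varE : \sum_j U j 0 ^+ 2 * norm2 (col j M) ^+ 2 = var (enum 'I_N) U.
  by rewrite /var big_enum.
have rest0 : rest (enum 'I_N) U = 0.
  by apply: big1 => j; rewrite mem_enum.
have := sqr_avg U (enum_uniq 'I_N); have := pow4_avg U (enum_uniq 'I_N).
rewrite rest0 norm2_0 !expr0n/= !(mulr0, mul0r, add0r) varE => H4 H2.
set t := Num.sqrt _; have tE : t ^+ 2 = var (enum 'I_N) U by rewrite sqr_sqrtr.
have [t0|t0] := eqVneq t 0.
  rewrite t0 mulr0.
  have := @sign_avg_ge (enum 'I_N) (fun U => norm2 (M *m U)) (fun=> 0) (fun=> 0) 0 0 U.
  by rewrite !mul0r subr0; apply => V; rewrite ?mul0r ?subr0 norm2_ge0.
have tp : 0 < t by rewrite lt_neqAle eq_sym t0 sqrtr_ge0.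
(* The pointwise bound is rescaled by [t]. With mean square [t^2] and mean fourth power at most
   [3 t^4] it yields [(3/4 - 3/16) t = 9/16 t], more than the [t / 2] wanted. *)
have := @sign_avg_ge (enum 'I_N) (fun U => norm2 (M *m U))
  (fun U => norm2 (M *m U) ^+ 2) (fun U => norm2 (M *m U) ^+ 4)
  (3 / 4 / t) (1 / 16 / t ^+ 3) U.
rewrite H2 => H; apply: le_trans (H _) => [|V].
  rewrite -tE in H4 *.
  have t3 : 0 <= 1 / 16 / t ^+ 3 by rewrite divr_ge0// exprn_ge0// ltW.
  have {}H4 := ler_wpM2l t3 H4.
  have E1 : 3 / 4 / t * t ^+ 2 = 3 / 4 * t by field.
  have E2 : 1 / 16 / t ^+ 3 * (3 * (t ^+ 2) ^+ 2) = 3 / 16 * t by field.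
  by rewrite E2 in H4; rewrite E1; lra.
set s := norm2 (M *m V); have s0 : 0 <= s := norm2_ge0 _.
(* A double root at [s = 2 t] makes the sign of the difference visible. *)
rewrite -subr_ge0 (_ : _ - _ = s * (s - 2 * t) ^+ 2 * (s + 4 * t) / (16 * t ^+ 3)); last first.
  by field.
have tge0 := ltW tp.
apply: divr_ge0; last by rewrite mulr_ge0// exprn_ge0.
by apply: mulr_ge0; [rewrite mulr_ge0// sqr_ge0|rewrite addr_ge0// mulr_ge0].
Qed.

Lemma frob_norm_cols : frob_norm M ^+ 2 = \sum_j norm2 (col j M) ^+ 2.
Proof.
rewrite frob_norm_sqr /frob_inner exchange_big; apply: eq_bigr => j _.
by rewrite norm2_sqr; apply: eq_bigr => i _; rewrite mxE expr2.
Qed.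

(** Cauchy-Schwarz trades the square root for an expression linear in the absolute values of the
    coordinates, whose mean involves first absolute moments only. *)
Lemma khintchine_frob (U : 'cV[R]_N) :
  1 / 2 * \sum_j `|U j 0| * norm2 (col j M) ^+ 2 <=
    frob_norm M * sign_avg (enum 'I_N) (fun U => norm2 (M *m U)) U.
Proof.
apply: le_trans (ler_wpM2l (frob_norm_ge0 M) (khintchine U)).
rewrite mulrCA ler_wpM2l// mulrC.
have := cauchy_schwarz_sum (fun j => `|U j 0| * norm2 (col j M)) (fun j => norm2 (col j M)).
rewrite -frob_norm_cols sqrtr_sqr (ger0_norm (frob_norm_ge0 _)).
under eq_bigr do rewrite -mulrA -expr2.
by under [X in _ <= Num.sqrt X * _]eq_bigr do rewrite exprMn real_normK ?num_real//.
Qed.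

End khintchine.

(* While [j + 1 < c] the contraction factor [1 - c / (j + 1)] is negative and the
   step is useless; the a priori bound [L] covers these indices. *)
Lemma robbins_monro_rate (R : realFieldType) (c M E L bias : R) (a : nat -> R) :
  1 < c -> 0 <= bias -> 0 <= E -> M <= E * (c - 1) -> a 0%N <= E ->
  (forall j, a j <= L) ->
  (forall j, j.+1%:R < c -> L <= E / j.+2%:R) ->
  (forall j, a j.+1 <= (1 - c / j.+1%:R) * a j + c / j.+1%:R * bias
                       + M / j.+1%:R ^+ 2) ->
  forall j, a j <= bias + E / j.+1%:R.
Proof.
move=> c1 bias0 E0 ME a0 aL LE step; elim=> [|j IH].
  by rewrite divr1 (le_trans a0)// lerDr.
have s0 : 0 < j.+1%:R :> R by rewrite ltr0n.
have [jc|cj] := ltP j.+1%:R c.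
  by apply: le_trans (aL _) _; apply: le_trans (LE _ jc) _; rewrite lerDr.
apply: le_trans (step j) _.
have k0 : 0 <= 1 - c / j.+1%:R by rewrite subr_ge0 ler_pdivrMr// mul1r.
apply: le_trans (lerD (lerD (ler_wpM2l k0 IH) (lexx _)) _) _.
  by apply: (ler_wpM2r _ ME); rewrite invr_ge0 sqr_ge0.
(* With [s = j + 1] the terms in [c] cancel, and [(s - 1) / s^2 <= 1 / (s + 1)] remains, that is
   [s^2 - 1 <= s^2]. *)
have -> : (1 - c / j.+1%:R) * (bias + E / j.+1%:R) + c / j.+1%:R * bias +
    E * (c - 1) / j.+1%:R ^+ 2 = bias + E * ((j.+1%:R - 1) / j.+1%:R ^+ 2).
  by field; rewrite gt_eqF.
rewrite lerD2l ler_wpM2l// ler_pdivrMr ?exprn_gt0// mulrC ler_pdivlMr ?ltr0n//.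
rewrite -natr1 -[j.+2%:R]natr1 -[j.+1%:R]natr1.
have j0 : 0 <= j%:R :> R by rewrite ler0n.
by move: (j%:R) j0 => z z0; nra.
Qed.

(** * The linear system *)

Section linear_system.
Context {R : realType} {n m r : nat} {T : Type}.
Variables (A : 'M[R]_n) (B : 'M[R]_(n, m)) (C : 'M[R]_(r, n)) (D : 'M[R]_(r, m)).
Variables (x w : nat -> T -> 'cV[R]_n) (u : nat -> T -> 'cV[R]_m) (y : nat -> T -> 'cV[R]_r).
Hypothesis xE : forall t om, x t.+1 om = A *m x t om + B *m u t om + w t om.
Hypothesis yE : forall t om, y t om = C *m x t om + D *m u t om.

Lemma state_unroll t j om : x (t + j)%N om = A ^+ j *m x t om +
  \sum_(i < j) A ^+ (j - i.+1) *m (B *m u (t + i)%N om + w (t + i)%N om).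
Proof.
elim: j => [|j IH]; first by rewrite addn0 expr0 mul1mx big_ord0 addr0.
rewrite addnS xE IH mulmxDr mulmxA -addrA -addrA exprS; congr (_ + _).
rewrite big_ord_recr /= subSS subnn expr0 mul1mx mulmx_sumr; congr (_ + _).
by apply: eq_bigr => i _; rewrite mulmxA subSn// exprS.
Qed.

(** The inputs of the window reach the output through exactly the blocks of [markov_matrix] and
    cancel. What is left is the state at time [t] and the attacks at [t, ..., t + k - 2]; the attack
    at [t + k - 1] acts only on the next state. *)
Lemma output_decomposition k t om : (0 < k)%N ->
  y (t + k - 1)%N om - markov_matrix k A B C D *m input_window k u (t + k - 1) om =
  C *m (A ^+ (k - 1) *m x t om) +
  C *m (\sum_(i < k - 1) A ^+ (k - 1 - i.+1) *m w (t + i)%N om).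
Proof.
case: k => // k _; rewrite subn1 addnS/= subn1/= yE.
rewrite /markov_matrix /input_window mul_mxrow_mxcol big_ord_recl /= subn0.
rewrite opprD addrA addrK state_unroll.
have -> : \sum_(i < k) A ^+ (k - i.+1) *m (B *m u (t + i)%N om + w (t + i)%N om) =
    \sum_(i < k) A ^+ (k - i.+1) *m (B *m u (t + i)%N om) +
    \sum_(i < k) A ^+ (k - i.+1) *m w (t + i)%N om.
  by rewrite -big_split; apply: eq_bigr => i _; rewrite mulmxDr.
rewrite !mulmxDr -!addrA; congr (_ + _).
rewrite addrCA -[RHS]addr0; congr (_ + _); apply/eqP; rewrite subr_eq0; apply/eqP.
(* The window lists the newest input first, hence the reversal of the sum. *)
rewrite mulmx_sumr (reindex_inj rev_ord_inj); apply: eq_bigr => i _ /=.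
by rewrite !mulmxA subnSK// subKn 1?ltnW// add0n /bump add1n addnBA.
Qed.

End linear_system.

(** * Measurability of matrix-valued functions *)

Section matrix_measurability.
Context {R : realType}.

Lemma measurable_entry m n (i : 'I_m) (j : 'I_n) :
  measurable_fun setT (fun M : 'M[R]_(m, n) => M i j).
Proof.
move=> _ Y mY; rewrite setTI; apply: sub_sigma_algebra.
by exists (i, j) => //; exists Y => //; rewrite setTI.
Qed.

Context {d : measure_display} {T : measurableType d}.

Lemma measurable_matrixP m n (f : T -> 'M[R]_(m, n)) :
  measurable_fun setT f <-> forall i j, measurable_fun setT (fun t => f t i j).
Proof.
split=> [mf i j|mf]; first exact: (measurableT_comp (measurable_entry i j)).
pose G := \bigcup_(ij in [set: 'I_m * 'I_n])
  preimage_set_system setT (fun M : 'M[R]_(m, n) => M ij.1 ij.2) measurable.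
apply: (@measurability _ _ _ _ _ _ G) => // _ [_ [[i j] _ [Y mY <-]] <-].
by rewrite setTI; exact: mf.
Qed.

Lemma measurable_mxD m n (f g : T -> 'M[R]_(m, n)) :
  measurable_fun setT f -> measurable_fun setT g ->
  measurable_fun setT (fun t => f t + g t).
Proof.
move=> /measurable_matrixP mf /measurable_matrixP mg; apply/measurable_matrixP => i j.
by under eq_fun do rewrite mxE; exact: measurable_funD.
Qed.

Lemma measurable_mxZ m n (a : T -> R) (f : T -> 'M[R]_(m, n)) :
  measurable_fun setT a -> measurable_fun setT f ->
  measurable_fun setT (fun t => a t *: f t).
Proof.
move=> ma /measurable_matrixP mf; apply/measurable_matrixP => i j.
by under eq_fun do rewrite mxE; exact: measurable_funM.
Qed.

Lemma measurable_mxB m n (f g : T -> 'M[R]_(m, n)) :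
  measurable_fun setT f -> measurable_fun setT g ->
  measurable_fun setT (fun t => f t - g t).
Proof.
move=> mf mg; under eq_fun do rewrite -scaleN1r.
by apply: measurable_mxD => //; exact: measurable_mxZ.
Qed.

Lemma measurable_mulmx m n p (f : T -> 'M[R]_(m, n)) (g : T -> 'M[R]_(n, p)) :
  measurable_fun setT f -> measurable_fun setT g ->
  measurable_fun setT (fun t => f t *m g t).
Proof.
move=> /measurable_matrixP mf /measurable_matrixP mg; apply/measurable_matrixP => i j.
under eq_fun do rewrite mxE; apply: measurable_sum => k.
exact: measurable_funM.
Qed.

Lemma measurable_frob_norm m n (f : T -> 'M[R]_(m, n)) :
  measurable_fun setT f -> measurable_fun setT (fun t => frob_norm (f t)).
Proof.
move=> /measurable_matrixP mf.
apply: (measurableT_comp (continuous_measurable_fun (@sqrt_continuous R))).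
apply: measurable_sum => i; apply: measurable_sum => j; exact: measurable_funM.
Qed.

Lemma measurable_norm2 n (f : T -> 'cV[R]_n) :
  measurable_fun setT f -> measurable_fun setT (fun t => norm2 (f t)).
Proof.
by move=> mf; under eq_fun do rewrite norm2E; exact: measurable_frob_norm.
Qed.

Lemma measurable_ball_proj m n (rad : R) (f : T -> 'M[R]_(m, n)) : 0 <= rad ->
  measurable_fun setT f -> measurable_fun setT (fun t => ball_proj rad (f t)).
Proof.
move=> rad0 mf; have mn := measurable_frob_norm mf.
(* The quotient is written with [expR] and [ln], since [frob_norm (f t)] is positive in the second
   branch; every piece is then a composition of measurable maps. *)
have E t : ball_proj rad (f t) = if frob_norm (f t) <= rad then f t
    else (rad * expR (- ln (frob_norm (f t)))) *: f t.
  rewrite /ball_proj; case: (leP (frob_norm (f t)) rad) => // radf.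
  by rewrite expRN lnK// posrE (le_lt_trans rad0 radf).
under eq_fun do rewrite E.
apply: measurable_fun_ifT => //; first exact: measurable_fun_ler.
apply: measurable_mxZ => //; apply: measurable_funM => //.
by do 2 apply: measurableT_comp => //; exact: measurableT_comp.
Qed.

Lemma measurable_input_window m k (u : nat -> T -> 'cV[R]_m) t :
  (forall j, (j < k)%N -> measurable_fun setT (u (t - j)%N)) ->
  measurable_fun setT (input_window k u t).
Proof.
move=> mu; apply/measurable_matrixP => i j.
under eq_fun do rewrite mxE.
have /measurable_matrixP := mu _ (ltn_ord (tagnat.sig1 i)); exact.
Qed.

End matrix_measurability.

(** * Moments of the normal distribution *)

Section gaussian_moments.
Context {R : realType}.
Local Notation mu := (@lebesgue_measure R).
Local Open Scope ereal_scope.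

(** The Radon-Nikodym derivative of the normal law agrees almost everywhere with the density, both
    having the same integral over every measurable set. *)
Lemma ge0_integral_normal_prob (m s : R) (f : R -> \bar R) :
  measurable_fun setT f -> (forall x, 0 <= f x) ->
  \int[normal_prob m s]_x f x = \int[mu]_x (f x * (normal_pdf m s x)%:E).
Proof.
move=> mf f0; have dom := @normal_prob_dominates R m s.
rewrite -(Radon_Nikodym_SigmaFinite.change_of_variables dom)//.
set h := Radon_Nikodym_SigmaFinite.f _ _.
have mpdf : measurable_fun setT (EFin \o normal_pdf m s).
  by apply/measurable_EFinP; exact: measurable_normal_pdf.
have ih : mu.-integrable setT h by exact: Radon_Nikodym_SigmaFinite.f_integrable.
have mh : measurable_fun setT h := measurable_int _ ih.
apply: ge0_ae_eq_integral => //.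
- exact: emeasurable_funM.
- exact: emeasurable_funM.
- by move=> x _; rewrite mule_ge0// Radon_Nikodym_SigmaFinite.f_ge0.
- by move=> x _; rewrite mule_ge0// lee_fin normal_pdf_ge0.
- apply: ae_eqe_mul2l; apply: integral_ae_eq => // E _ mE.
  by rewrite -Radon_Nikodym_SigmaFinite.f_integral.
Qed.

Lemma normal_pdf_exp (s x : R) : (0 < s)%R ->
  normal_pdf 0 s x = (normal_peak s * expR (- (2 * s ^+ 2)^-1 * x ^+ 2))%R.
Proof.
move=> s0; rewrite normal_pdfE ?gt_eqF// /normal_fun subr0.
by congr (_ * expR _)%R; rewrite mulr_natl !mulNr [in LHS]mulrC.
Qed.

Lemma normal_prob_opp (s : R) (A : set R) : (0 < s)%R -> measurable A ->
  normal_prob 0 s (-%R @^-1` A) = normal_prob 0 s A.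
Proof.
move=> s0 mA; rewrite /normal_prob.
have pdfN x : normal_pdf 0 s (- x)%R = normal_pdf 0 s x.
  by rewrite !normal_pdf_exp// sqrrN.
transitivity (\int[mu]_(x in -%R @^-1` A) ((fun x => (normal_pdf 0 s x)%:E) \o -%R) x).
  by apply: eq_integral => x _ /=; rewrite pdfN.
rewrite -(@ge0_integral_pushforward _ _ (measurableTypeR R) (measurableTypeR R) _ -%R _
  mu _ (fun x => (normal_pdf 0 s x)%:E))//.
- by apply: eq_measure_integral => // B mB _; exact: lebesgue_measureN.
- by apply/measurable_EFinP/measurable_funTS; exact: measurable_normal_pdf.
- by move=> x _; rewrite lee_fin normal_pdf_ge0.
Qed.

Let is_derive_gauss (k c x : R) : is_derive x 1%R
  (fun z : R => k * expR (c * z ^+ 2))%R (k * (expR (c * x ^+ 2) * (c * (2 * x))))%R.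
Proof.
have d1 : is_derive x 1%R (fun z : R => c * z ^+ 2)%R (c * (2 * x))%R.
  by apply: is_derive_eq; rewrite /GRing.scale/=; ring.
have d2 : is_derive x 1%R (fun z : R => expR (c * z ^+ 2))
    (expR (c * x ^+ 2) * (c * (2 * x)))%R.
  exact: (@is_derive1_comp _ expR (fun z : R => c * z ^+ 2)%R).
exact: (@is_deriveZ _ _ _ _ k _ _ _ d2).
Qed.

(** Twice the half-line integral, by symmetry; there [- s ^+ 2] times the density is an
    antiderivative. *)
Lemma normal_abs_moment (s : R) : (0 < s)%R ->
  \int[normal_prob 0 s]_x (`|x|%R)%:E = (2 * s / Num.sqrt (2 * pi))%:E.
Proof.
move=> s0; rewrite ge0_integral_normal_prob//; last first.
  by apply/measurable_EFinP; exact: normr_measurable.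
pose f (x : R) := (`|x| * normal_pdf 0 s x)%R.
have cpdf : continuous (normal_pdf 0 s) by apply: continuous_normal_pdf; rewrite gt_eqF.
have cf : continuous f.
  by move=> x; apply: cvgM; [exact: norm_continuous|exact: cpdf].
rewrite (_ : \int[mu]_x _ = \int[mu]_x (f x)%:E); last first.
  by apply: eq_integral => x _; rewrite -EFinM.
rewrite ge0_symfun_integralT//; last 2 first.
  by move=> x; rewrite mulr_ge0// normal_pdf_ge0.
  by move=> x; rewrite /f /= normrN !normal_pdf_exp// sqrrN.
pose c : R := (- (2 * s ^+ 2)^-1)%R; pose k := (- s ^+ 2 * normal_peak s)%R.
pose F (x : R) := (k * expR (c * x ^+ 2))%R.
have dF x := is_derive_gauss k c x.
rewrite -set_itvcy (@ge0_continuous_FTC2y _ f F 0 0)%R.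
- rewrite /F expr0n/= mulr0 expR0 mulr1 -EFinB -EFinM.
  congr _%:E; rewrite /k /normal_peak mulNr opprK add0r -mulrnAr sqrtrM ?sqr_ge0//.
  rewrite sqrtr_sqr gtr0_norm// -(mulr_natl pi); field.
  by rewrite !gt_eqF// sqrtr_gt0 mulr_gt0// pi_gt0.
- by move=> x x0; rewrite mulr_ge0// normal_pdf_ge0.
- exact: continuous_subspaceT.
(* At infinity [F] tends to 0, being [k] times a rescaled [gauss_fun]. *)
- rewrite -[X in _ --> X](mulr0 k); apply: cvgMl_tmp.
  pose a := (Num.sqrt (2 * s ^+ 2))^-1%R.
  have a0 : (0 < a)%R by rewrite invr_gt0 sqrtr_gt0 mulr_gt0// exprn_gt0.
  rewrite (_ : (fun x => _) = gauss_fun \o (fun x => x * a)%R).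
    apply: cvg_comp; last exact: cvg_gauss_fun.
    exact: (gt0_cvgMly a0).
  apply/funext => x /=; rewrite /gauss_fun /c exprMn /a exprVn sqr_sqrtr.
    by congr expR; ring.
  by rewrite mulr_ge0// sqr_ge0.
- by move=> x _; exact: ex_derive.
- apply: cvg_at_right_filter; apply: differentiable_continuous.
  exact/derivable1_diffP/ex_derive.
- move=> x; rewrite in_itv/= andbT => x0; rewrite derive1E derive_val /f.
  rewrite gtr0_norm// normal_pdf_exp// /k -/c.
  have cE : (c * (2 * s ^+ 2) = -1)%R.
    by rewrite /c mulNr mulVf// mulf_neq0// expf_neq0// gt_eqF.
  transitivity ((- (c * (2 * s ^+ 2))) * (x * (normal_peak s * expR (c * x ^+ 2))))%R.
    by ring.
  by rewrite cE opprK mul1r.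
Qed.

(* [1 + z <= exp z] bounds the second moment by total masses of wider
   Gaussians, so only the normalization of the density is needed. *)
Lemma normal_second_moment (s : R) : (0 < s)%R ->
  \int[normal_prob 0 s]_x (x ^+ 2)%:E <= (s ^+ 2)%:E.
Proof.
move=> s0; have mx2 : measurable_fun setT (fun x : R => (x ^+ 2)%:E).
  by apply/measurable_EFinP; exact: exprn_measurable.
rewrite ge0_integral_normal_prob//; last by move=> x; rewrite lee_fin sqr_ge0.
apply/lee_addgt0Pr => e e0; rewrite -EFinD.
pose t := Num.sqrt (s ^+ 2 + e).
have tE : (t ^+ 2 = s ^+ 2 + e)%R by rewrite sqr_sqrtr// addr_ge0 ?sqr_ge0// ltW.
have t0 : (0 < t)%R by rewrite sqrtr_gt0 ltr_wpDl ?sqr_ge0.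
(* The slack [e] makes [t > s], hence [h > 0]. This [h] is such that [exp (h x^2)] times the density
   of deviation [s] equals [t / s] times that of deviation [t]. *)
pose h := ((s ^- 2 - t ^- 2) / 2)%R.
have h0 : (0 < h)%R.
  by rewrite divr_gt0// subr_gt0 ltf_pV2 ?posrE ?exprn_gt0// tE ltrDl.
have mpdf (s' : R) : measurable_fun setT (EFin \o normal_pdf 0 s').
  by apply/measurable_EFinP; exact: measurable_normal_pdf.
have pdf0 (s' x : R) : 0 <= (normal_pdf 0 s' x)%:E by rewrite lee_fin normal_pdf_ge0.
have mxp : measurable_fun setT (fun x : R => (x ^+ 2)%:E * (normal_pdf 0 s x)%:E).
  exact: (emeasurable_funM mx2 (mpdf s)).
set I := \int[mu]_x _.
have : h%:E * I + 1 <= (t / s)%:E.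
  rewrite -(@integral_normal_pdf R 0 s) -[leRHS]mule1 -(@integral_normal_pdf R 0 t).
  rewrite -!ge0_integralZl//; [|exact: mpdf|by rewrite lee_fin divr_ge0// ltW
    |by move=> x _; rewrite mule_ge0// lee_fin sqr_ge0
    |by rewrite lee_fin ltW].
  have m1 : measurable_fun setT (fun x : R => h%:E * ((x ^+ 2)%:E * (normal_pdf 0 s x)%:E)).
    exact: (emeasurable_funM _ mxp).
  have p1 (x : R) : 0 <= h%:E * ((x ^+ 2)%:E * (normal_pdf 0 s x)%:E).
    by rewrite !mule_ge0// lee_fin ?sqr_ge0// ltW.
  rewrite -ge0_integralD//; last exact: mpdf.
  apply: ge0_le_integral => //.
  - by move=> x _; rewrite adde_ge0.
  - exact: (emeasurable_funD m1 (mpdf s)).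
  - exact: (emeasurable_funM _ (mpdf t)).
  - move=> x _; rewrite -!EFinM -EFinD lee_fin !normal_pdf_exp//.
    have -> : normal_peak t = (normal_peak s * (s / t))%R.
      have pE (z : R) : (0 < z)%R -> (normal_peak z = z^-1 * (Num.sqrt (pi *+ 2))^-1)%R.
        move=> z0; rewrite /normal_peak -mulrnAr sqrtrM ?sqr_ge0//.
        by rewrite sqrtr_sqr gtr0_norm// invfM.
      rewrite !pE//; field.
      by rewrite !gt_eqF// sqrtr_gt0 mulrn_wgt0// pi_gt0.
    have -> : (expR (- (2 * t ^+ 2)^-1 * x ^+ 2) =
               expR (- (2 * s ^+ 2)^-1 * x ^+ 2) * expR (h * x ^+ 2))%R.
      by rewrite -expRD /h; congr expR; field; rewrite !gt_eqF.
    set p := normal_peak s; set q := expR _; set r := expR _.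
    have pq : (0 <= p * q)%R by rewrite mulr_ge0 ?normal_peak_ge0 ?expR_ge0.
    have rx : (1 + h * x ^+ 2 <= r)%R by exact: expR_ge1Dx.
    have -> : (t / s * (p * (s / t) * (q * r)) = p * q * r)%R.
      by field; rewrite !gt_eqF.
    have := ler_wpM2l pq rx; lra.
have I0 : 0 <= I by apply: integral_ge0 => x _; rewrite mule_ge0// lee_fin sqr_ge0.
case: I I0 => [I| |]//; last by rewrite gt0_muley// lte_fin.
rewrite -EFinM -EFinD !lee_fin => I0 H.
(* With [z = t / s] the bound reads [h I <= z - 1], and [h t^2 = (z^2 - 1) / 2 >= z - 1]. *)
rewrite -tE -(ler_pM2l h0).
have -> : (h * t ^+ 2 = ((t / s) ^+ 2 - 1) / 2)%R.
  by rewrite /h; field; rewrite !gt_eqF.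
by have := sqr_ge0 (t / s - 1)%R; move: (t / s)%R H => z; rewrite expr2; nra.
Qed.

End gaussian_moments.

(** * Independence and sign-invariant laws *)

Section independence_integral.
Context {d d1 d2 : measure_display} {T : measurableType d}.
Context {T1 : measurableType d1} {T2 : measurableType d2} {R : realType}.
Local Open Scope ereal_scope.

Lemma ge0_integral_mrestr (mu : {measure set T -> \bar R}) (S : set T)
    (mS : measurable S) (f : T -> \bar R) :
  measurable_fun setT f -> (forall x, 0 <= f x) ->
  \int[mrestr mu mS]_x f x = \int[mu]_(x in S) f x.
Proof.
move=> mf f0; rewrite -(setUv S) ge0_integral_setU//=; last 3 first.
- exact: measurableC.
- by rewrite setUv.
- exact/disj_setPCl.
rewrite [X in _ + X]null_set_integral ?adde0//; last 3 first.
- exact: measurableC.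
- exact: measurable_funTS.
- by rewrite /= /mrestr setICl measure0.
by apply: eq_measure_integral => A mA AS /=; rewrite /mrestr setIidl.
Qed.

(** On [S] the joint law of [X] and [Y] is [P S] times the product of their laws: on rectangles by
    hypothesis, hence everywhere by uniqueness of product measures. Tonelli concludes. *)
Lemma ge0_integral_independent (P : probability T R) (X : {RV P >-> T1})
    (Y : {RV P >-> T2}) (S : set T) (h : T1 * T2 -> \bar R) : measurable S ->
  (forall A B, measurable A -> measurable B ->
     P (S `&` (X @^-1` A `&` Y @^-1` B)) = P S * (P (X @^-1` A) * P (Y @^-1` B))) ->
  measurable_fun setT h -> (forall z, 0 <= h z) ->
  \int[P]_(om in S) h (X om, Y om) =
  P S * \int[distribution P Y]_y \int[distribution P X]_x h (x, y).
Proof.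
move=> mS indep mh h0.
have mXY : measurable_fun setT (fun om => (X om, Y om)) by exact: measurable_fun_pair.
have [p p0 PSp] : exists2 p : R, (0 <= p)%R & P S = p%:E.
  exists (fine (P S)); first exact: fine_ge0.
  by rewrite fineK// fin_num_measure.
pose XY : {mfun T >-> (T1 * T2)%type} := HB.pack (fun om => (X om, Y om))
  (isMeasurableFun.Build _ _ _ _ _ mXY).
pose m := pushforward (mrestr P mS) XY.
transitivity (\int[mrestr P mS]_om (h \o XY) om).
  by rewrite ge0_integral_mrestr// => [|om]; [exact: (measurableT_comp mh mXY)|exact: h0].
transitivity (\int[m]_z h z).
  by rewrite ge0_integral_pushforward//.
(* The factor [P S] is absorbed into the law of [Y], so that a genuine product measure appears. *)
pose m2 := mscale (NngNum p0) (distribution P Y).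
transitivity (\int[(distribution P X \x m2)]_z h z).
  apply: eq_measure_integral => A mA _; apply/esym.
  apply: product_measure_unique => // B C mB mC.
  rewrite [LHS](_ : _ = P (S `&` (X @^-1` B `&` Y @^-1` C))).
    by rewrite indep// PSp muleCA.
  by rewrite setIC.
rewrite fubini_tonelli2// ge0_integral_mscale//=; first by rewrite PSp.
- exact: measurable_fun_fubini_tonelli_G.
- by move=> y _; exact: integral_ge0.
Qed.

End independence_integral.

(** * Laws of column vectors invariant under sign changes *)

Section symmetric_law.
Context {R : realType} {N : nat}.
Local Open Scope ereal_scope.

Definition box (S : 'I_N -> set R) : set 'cV[R]_N := [set v | forall i, S i (v i 0%R)].

Lemma measurable_box (S : 'I_N -> set R) :
  (forall i, measurable (S i)) -> measurable (box S).
Proof.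
move=> mS; rewrite (_ : box S = \bigcap_(i in [set: 'I_N]) (fun v => v i 0%R) @^-1` S i).
  apply: fin_bigcap_measurable => [|i _]; first exact: finite_finset.
  by rewrite -[X in measurable X]setTI; exact: measurable_entry.
by apply/seteqP; split => [v Sv i _|v Sv i]; exact: Sv.
Qed.

(** Boxes form a pi-system that generates the sigma-algebra. *)
Lemma measure_box_unique (m1 m2 : {measure set 'cV[R]_N -> \bar R}) :
  m1 setT < +oo ->
  (forall S, (forall i, measurable (S i)) -> m1 (box S) = m2 (box S)) ->
  forall A, measurable A -> m1 A = m2 A.
Proof.
move=> m1oo m12 A mA.
pose G := [set B | exists2 S, (forall i, measurable (S i)) & B = box S].
have GT : G setT by exists (fun=> setT) => //; apply/seteqP.
apply: (@g_sigma_algebra_measure_unique _ R _ G _ (fun=> setT)) => //.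
- by move=> _ [S mS ->]; exact: measurable_box.
- by rewrite bigcup_const.
- move=> _ _ [S mS ->] [S' mS' ->]; exists (fun i => S i `&` S' i).
    by move=> i; exact: measurableI.
  apply/seteqP; split=> [v [Sv S'v] i|v Sv]; first by split; [exact: Sv|exact: S'v].
  by split=> i; have [] := Sv i.
- by move=> _ [S mS ->]; exact: m12.
- move: A mA; apply: smallest_sub; first exact: smallest_sigma_algebra.
  move=> _ [[i j] _ [Y mY <-]]; apply: sub_sigma_algebra.
  exists (fun k => if k == i then Y else setT).
    by move=> k; case: ifP.
  rewrite setTI; apply/seteqP; split=> v /= Yv.
    by move=> k; case: ifPn => // /eqP ->; rewrite -(ord1 j).
  by have := Yv i; rewrite eqxx (ord1 j).
Qed.

Lemma measurable_flip (j : 'I_N) : measurable_fun setT (flip j : 'cV[R]_N -> _).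
Proof.
apply/measurable_matrixP => i k; under eq_fun do rewrite mxE.
case: (i == j); last exact: measurable_entry.
by apply: measurableT_comp => //; exact: measurable_entry.
Qed.

Variable mu : {measure set 'cV[R]_N -> \bar R}.
Hypothesis mu_flip : forall j A, measurable A -> mu (flip j @^-1` A) = mu A.

Lemma measurable_sign_avg l (h : 'cV[R]_N -> R) :
  measurable_fun setT h -> measurable_fun setT (sign_avg l h).
Proof.
move=> mh; elim: l => [//|j l IH] /=; apply: measurable_funM => //.
by apply: measurable_funD => //; apply: measurableT_comp => //; exact: measurable_flip.
Qed.

Lemma sign_avg_ge0 l (h : 'cV[R]_N -> R) :
  (forall v, 0 <= h v)%R -> forall v, (0 <= sign_avg l h v)%R.
Proof.
by move=> h0; elim: l => [//|j l IH] v /=; rewrite divr_ge0// addr_ge0.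
Qed.

(** Each flip preserves [mu], so the two halves of every mean have equal integrals. *)
Lemma integral_sign_avg l (h : 'cV[R]_N -> R) :
  measurable_fun setT h -> (forall v, 0 <= h v)%R ->
  \int[mu]_v (sign_avg l h v)%:E = \int[mu]_v (h v)%:E.
Proof.
move=> mh h0; elim: l => [//|j l IH] /=.
have ms := measurable_sign_avg l mh; have s0 := sign_avg_ge0 l h0.
have mf := measurable_flip j.
have flipE : \int[mu]_v (sign_avg l h (flip j v))%:E = \int[mu]_v (sign_avg l h v)%:E.
  transitivity (\int[pushforward mu (flip j)]_v (sign_avg l h v)%:E).
    rewrite (ge0_integral_pushforward mf)//; first exact/measurable_EFinP.
    by move=> v _; rewrite lee_fin.
  by apply: eq_measure_integral => A mA _; exact: mu_flip.
under eq_integral do rewrite EFinM EFinD muleC.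
rewrite ge0_integralZl//=; last 2 first.
  by apply: emeasurable_funD; apply/measurable_EFinP => //; exact: measurableT_comp.
  by move=> v _; rewrite adde_ge0// lee_fin.
rewrite ge0_integralD//=; last 4 first.
- by move=> v _; rewrite lee_fin.
- exact/measurable_EFinP.
- by move=> v _; rewrite lee_fin.
- by apply/measurable_EFinP; exact: measurableT_comp.
by rewrite flipE IH -mule2n -mule_natl muleA -EFinM mulVf// mul1e.
Qed.

(** By invariance the norm may be replaced by its sign average, to which [khintchine_frob] applies
    pointwise after multiplication by [frob_norm M]. *)
Lemma norm2_mulmx_moment_ge r (M : 'M[R]_(r, N)) (c : R) : (0 <= c)%R ->
  (forall j, \int[mu]_v (`|v j 0%R|%R)%:E = c%:E) ->
  (1 / 2 * c * frob_norm M)%:E <= \int[mu]_v (norm2 (M *m v))%:E.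
Proof.
move=> c0 absE.
have mh : measurable_fun setT (fun v => norm2 (M *m v)).
  by apply: measurable_norm2; apply: measurable_mulmx.
have [M0|M0] := eqVneq (frob_norm M) 0%R.
  by rewrite M0 mulr0 integral_ge0// => v _; rewrite lee_fin norm2_ge0.
have Mp : (0 < frob_norm M)%R by rewrite lt_neqAle eq_sym M0 frob_norm_ge0.
rewrite -(integral_sign_avg (enum 'I_N) mh (fun=> norm2_ge0 _)).
rewrite -(@lee_pmul2l _ (frob_norm M)%:E)//.
have ms := measurable_sign_avg (enum 'I_N) mh.
have s0 := sign_avg_ge0 (enum 'I_N) (fun v => norm2_ge0 (M *m v)).
rewrite -ge0_integralZl//; last 3 first.
- exact/measurable_EFinP.
- by move=> v _; rewrite lee_fin.
- by rewrite lee_fin ltW.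
have E : (frob_norm M)%:E * (1 / 2 * c * frob_norm M)%:E =
    \int[mu]_v (1 / 2 * \sum_j `|v j 0%R| * norm2 (col j M) ^+ 2)%:E.
  have mabs j : measurable_fun setT (fun v : 'cV[R]_N => `|v j 0%R|%R).
    by apply: measurableT_comp => //; exact: measurable_entry.
  under eq_integral do rewrite EFinM -sumEFin.
  rewrite ge0_integralZl//; last 2 first.
  - by apply: emeasurable_sum => j; apply/measurable_EFinP; exact: measurable_funM.
  - by move=> v _; apply: sume_ge0 => j _; rewrite lee_fin mulr_ge0// sqr_ge0.
  rewrite ge0_integral_sum//; last 2 first.
  - by move=> j; apply/measurable_EFinP; exact: measurable_funM.
  - by move=> j v _; rewrite lee_fin mulr_ge0// sqr_ge0.
  under [in RHS]eq_bigr => j _.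
    under eq_integral do rewrite EFinM muleC.
    rewrite ge0_integralZl//; last 2 first.
    - exact/measurable_EFinP.
    - by rewrite lee_fin sqr_ge0.
    rewrite absE -EFinM; over.
  rewrite sumEFin -EFinM -EFinM -mulr_suml -frob_norm_cols; congr _%:E; ring.
rewrite E; apply: ge0_le_integral => //.
- move=> v _; rewrite lee_fin mulr_ge0// sumr_ge0// => j _.
  by rewrite mulr_ge0// sqr_ge0.
- apply/measurable_EFinP/measurable_funM => //; apply: measurable_sum => j.
  apply: measurable_funM => //; apply: measurableT_comp => //; exact: measurable_entry.
- by apply/measurable_EFinP; exact: measurable_funM.
- by move=> v _; rewrite -EFinM lee_fin khintchine_frob.
Qed.

End symmetric_law.

Section independence.
Context {d : measure_display} {T : measurableType d} {R : realType}.
Variable P : probability T R.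
Local Open Scope ereal_scope.

(** Independence is formulated for finite sets of indices; this form takes a list of events whose
    indices are given by an injection, as time windows require. *)
Lemma mutually_independent_inj (I : choiceType) (F : I -> set (set T)) k
    (f : 'I_k -> I) (E : 'I_k -> set T) :
  mutually_independent P F -> injective f -> (forall j, F (f j) (E j)) ->
  P (\bigcap_(j in [set: 'I_k]) E j) = \prod_(j < k) P (E j).
Proof.
move=> indep finj FE; pose J := [fset x in [seq f j | j <- enum 'I_k]]%fset.
(* Outside the image of [f] the value [setT] is a mere default, since [J] is that image. *)
pose E' i := if [pick j | f j == i] is Some j then E j else setT.
have E'E j : E' (f j) = E j.
  rewrite /E'; case: pickP => [j' /eqP /finj -> //|/(_ j)].
  by rewrite eqxx.
have fJ j : f j \in J by rewrite in_fset; apply: map_f; rewrite mem_enum.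
have Jf i : i \in J -> exists j, i = f j.
  by rewrite in_fset => /mapP[j _ ->]; exists j.
have := indep J E'; rewrite (_ : \bigcap_(i in [set` J]) E' i =
    \bigcap_(j in [set: 'I_k]) E j); last first.
  apply/seteqP; split => [x JE j _|x JE i /= /Jf [j ->]].
    by rewrite -E'E; exact: (JE _ (fJ j)).
  by rewrite E'E; exact: JE.
move=> ->; last by move=> i /Jf [j ->]; rewrite E'E.
rewrite (perm_big [seq f j | j <- enum 'I_k]); last first.
  rewrite uniq_perm ?fset_uniq ?(map_inj_uniq finj) ?enum_uniq// => i.
  by rewrite in_fset.
by rewrite big_map big_enum; apply: eq_bigr => j _; rewrite E'E.
Qed.

Section isotropic.
Context {m : nat} {sigma : R}.
Variable X : {RV P >-> 'cV[R]_m}.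
Hypothesis X_gauss : isotropic_gaussian sigma X.

Lemma isotropic_coord i (Y : set R) : measurable Y ->
  P ((fun om => X om i 0%R) @^-1` Y) = normal_prob 0 sigma Y.
Proof.
move=> mY; pose S (j : 'I_m) := if j == i then Y else [set: R].
have mS j : measurable (S j) by rewrite /S; case: ifP.
have := X_gauss mS; rewrite (bigD1 i)//= {2}/S eqxx big1 ?mule1 => [<-|j ji].
  congr (P _); apply/seteqP; split => om /= XY; last by have := XY i; rewrite /S eqxx.
  by move=> j; rewrite /S; case: ifPn => // /eqP ->.
by rewrite /S (negbTE ji) probability_setT.
Qed.

Lemma integral_isotropic_coord i (f : R -> \bar R) :
  measurable_fun setT f -> (forall x, 0 <= f x) ->
  \int[P]_om f (X om i 0%R) = \int[normal_prob 0 sigma]_x f x.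
Proof.
move=> mf f0.
have mX : measurable_fun setT (fun om => X om i 0%R).
  by have /measurable_matrixP := measurable_funPT X; exact.
pose Xi : {mfun T >-> measurableTypeR R} := HB.pack (fun om => X om i 0%R)
  (isMeasurableFun.Build _ _ _ (measurableTypeR R) _ mX).
transitivity (\int[distribution P Xi]_x f x).
  by rewrite ge0_integral_distribution.
by apply: eq_measure_integral => A mA _; exact: isotropic_coord.
Qed.

Lemma isotropic_second_moment : (0 < sigma)%R ->
  \int[P]_om (norm2 (X om) ^+ 2)%:E <= (m%:R * sigma ^+ 2)%:E.
Proof.
move=> s0; under eq_integral do rewrite norm2_sqr -sumEFin.
have mX2 i : measurable_fun setT (fun om => (X om i 0%R ^+ 2)%:E).
  apply/measurable_EFinP; apply: measurable_funX.
  by have /measurable_matrixP := measurable_funPT X; exact.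
rewrite ge0_integral_sum//; last by move=> i om _; rewrite lee_fin sqr_ge0.
rewrite mulr_natl -[X in (sigma ^+ 2 *+ X)%R]card_ord -sumr_const -sumEFin.
apply: lee_sum => i _; apply: le_trans (normal_second_moment s0).
rewrite (integral_isotropic_coord i (f := fun x => (x ^+ 2)%:E))//.
  by apply/measurable_EFinP; exact: exprn_measurable.
by move=> x; rewrite lee_fin sqr_ge0.
Qed.

End isotropic.

(** * The law of a window of Gaussian inputs *)

Section gaussian_window.
Context {m : nat} {sigma : R}.
Hypothesis sigma_gt0 : (0 < sigma)%R.
Variable u : nat -> {RV P >-> 'cV[R]_m}.
Hypothesis u_indep : mutually_independent P (fun t => g_sigma_algebra_preimage (u t)).
Hypothesis u_gaussian : forall t, isotropic_gaussian sigma (u t).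
Variables (k t : nat).
Hypothesis kt : (k <= t.+1)%N.
Variable U : {RV P >-> 'cV[R]_(\sum_(j < k) m)}.
Hypothesis UE : forall om, U om = input_window k u t om.

Let UE_coord om i : U om i 0%R = u (t - tagnat.sig1 i)%N om (tagnat.sig2 i) 0%R.
Proof. by rewrite UE /input_window mxE. Qed.

Let U_Rank om (j : 'I_k) (l : 'I_m) : U om (tagnat.Rank j l) 0%R = u (t - j)%N om l 0%R.
Proof.
rewrite UE /input_window.
have := mxcolK (fun j : 'I_k => u (t - j)%N om) j.
by move=> /matrixP/(_ l 0%R); rewrite mxE.
Qed.

Lemma window_box S : (forall i, measurable (S i)) ->
  distribution P U (box S) =
  \prod_(j < k) \prod_(l < m) normal_prob 0 sigma (S (tagnat.Rank j l)).
Proof.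
move=> mS.
(* Truncated subtraction is injective here because [kt] gives [j <= t] for [j < k]. *)
have finj : injective (fun j : 'I_k => t - j)%N.
  move=> i j /(congr1 (subn t)); rewrite !subKn; first exact: val_inj.
    by rewrite -ltnS (leq_trans (ltn_ord j)).
  by rewrite -ltnS (leq_trans (ltn_ord i)).
transitivity (P (\bigcap_(j in [set: 'I_k])
    (u (t - j)%N @^-1` box (fun l => S (tagnat.Rank j l))))).
  congr (P _); apply/seteqP; split => [om /= bU j _ l|om bu i].
    by rewrite -U_Rank; exact: bU.
  by rewrite -(tagnat.sig2K i) U_Rank; exact: bu.
rewrite (mutually_independent_inj u_indep finj).
  apply: eq_bigr => j _; exact: (u_gaussian (t - j)%N (fun l => mS _)).
move=> j; exists (box (fun l => S (tagnat.Rank j l))); last by rewrite setTI.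
by apply: measurable_box => l; exact: mS.
Qed.

(** Boxes determine the measure; the flip only reflects one side of a box, and the centred normal
    law is symmetric. *)
Lemma window_flip j A : measurable A ->
  distribution P U (flip j @^-1` A) = distribution P U A.
Proof.
pose flipj : {mfun 'cV[R]_(\sum_(i < k) m) >-> 'cV[R]_(\sum_(i < k) m)} :=
  HB.pack (flip j) (isMeasurableFun.Build _ _ _ _ _ (measurable_flip j)).
pose m1 := distribution (distribution P U) flipj.
move=> mA; suff: m1 A = distribution P U A by [].
apply: (@measure_box_unique _ _ m1 (distribution P U)) mA => [|S mS].
  by rewrite /= /m1 /distribution /pushforward !preimage_setT probability_setT ltry.
pose S' i := if i == j then -%R @^-1` S i else S i.
have mS' i : measurable (S' i).
  rewrite /S'; case: ifP => // _; rewrite -[X in measurable X]setTI.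
  exact: (oppr_measurable measurableT).
transitivity (distribution P U (box S')).
  congr (distribution P U _); apply/seteqP.
  by split => v /= Sv i; have := Sv i; rewrite /S' mxE; case: ifP.
rewrite [RHS](window_box mS) (window_box mS'); apply: eq_bigr => a _; apply: eq_bigr => b _.
by rewrite /S'; case: ifP => // _; exact: normal_prob_opp.
Qed.

Lemma window_second_moment :
  \int[P]_om (norm2 (U om) ^+ 2)%:E <= ((m * k)%:R * sigma ^+ 2)%:E.
Proof.
under eq_integral do rewrite norm2_sqr -sumEFin.
have mU2 i : measurable_fun setT (fun om => (U om i 0%R ^+ 2)%:E).
  apply/measurable_EFinP; apply: measurable_funX.
  by have /measurable_matrixP := measurable_funPT U; exact.
rewrite ge0_integral_sum//; last by move=> i om _; rewrite lee_fin sqr_ge0.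
have -> : ((m * k)%:R * sigma ^+ 2 = \sum_(i < \sum_(j < k) m) sigma ^+ 2)%R.
  by rewrite sumr_const card_ord sum_nat_const card_ord mulr_natl mulnC.
rewrite -sumEFin; apply: lee_sum => i _.
apply: le_trans (normal_second_moment sigma_gt0).
under eq_integral do rewrite UE_coord.
rewrite (integral_isotropic_coord (u_gaussian _) _ (f := fun x => (x ^+ 2)%:E))//.
  by apply/measurable_EFinP; exact: exprn_measurable.
by move=> x; rewrite lee_fin sqr_ge0.
Qed.

(** The constant is half the mean absolute value [2 sigma / sqrt (2 pi)] of a coordinate, the half
    being the Khintchine loss. *)
Lemma window_norm_moment_ge r (M : 'M[R]_(r, \sum_(j < k) m)) :
  (sigma / Num.sqrt (2 * pi) * frob_norm M)%:E <=
  \int[distribution P U]_v (norm2 (M *m v))%:E.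
Proof.
have c0 : (0 <= 2 * sigma / Num.sqrt (2 * pi))%R.
  by rewrite divr_ge0 ?sqrtr_ge0// mulr_ge0// ltW.
have := @norm2_mulmx_moment_ge _ _ (distribution P U) window_flip r M _ c0.
rewrite (_ : 1 / 2 * (2 * sigma / Num.sqrt (2 * pi)) = sigma / Num.sqrt (2 * pi))%R.
  apply => i.
  rewrite (ge0_integral_distribution U (f := fun v => `|v i 0%R|%:E))//.
    under eq_integral do rewrite /= UE_coord.
    rewrite (integral_isotropic_coord (u_gaussian _) _ (f := fun x : R => `|x|%:E))//.
      by rewrite normal_abs_moment.
    by apply/measurable_EFinP; exact: normr_measurable.
  apply/measurable_EFinP; apply: measurableT_comp => //.
  exact: measurable_entry.
by field; rewrite gt_eqF// sqrtr_gt0 mulr_gt0// pi_gt0.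
Qed.

End gaussian_window.
End independence.

(** * Mean bounds and measurability of the iterates *)

Section mean_bounds.
Context {d : measure_display} {T : measurableType d} {R : realType}.
Variable P : probability T R.
Local Open Scope ereal_scope.

(** Pointwise [f <= s / 2 * (1 + f^2 / s^2) <= s / 2 * exp (f^2 / s^2)], and the exponential has
    mean at most 2. *)
Lemma mean_le_of_exp_sqr (f : T -> R) (s : R) : measurable_fun setT f ->
  (forall om, 0 <= f om)%R -> (0 < s)%R ->
  \int[P]_om (expR (f om ^+ 2 / s ^+ 2))%:E <= 2%:E -> \int[P]_om (f om)%:E <= s%:E.
Proof.
move=> mf f0 s0 H.
have me : measurable_fun setT (fun om => (expR (f om ^+ 2 / s ^+ 2))%:E).
  apply/measurable_EFinP; apply: measurableT_comp => //.
  by apply: measurable_funM => //; exact: measurable_funX.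
apply: (@le_trans _ _ ((s / 2)%:E * \int[P]_om (expR (f om ^+ 2 / s ^+ 2))%:E)).
  rewrite -ge0_integralZl//; last by rewrite lee_fin divr_ge0// ltW.
  apply: ge0_le_integral => //.
  - by move=> om _; rewrite lee_fin.
  - exact/measurable_EFinP.
  - exact: emeasurable_funM.
  move=> om _; rewrite -EFinM lee_fin.
  have := expR_ge1Dx (f om ^+ 2 / s ^+ 2)%R; set e := expR _ => He.
  apply: (@le_trans _ _ (s / 2 * (1 + f om ^+ 2 / s ^+ 2))%R); last first.
    by rewrite ler_wpM2l// divr_ge0// ltW.
  have -> : (s / 2 * (1 + f om ^+ 2 / s ^+ 2) = f om + (s - f om) ^+ 2 / (2 * s))%R.
    by field; rewrite gt_eqF.
  by rewrite lerDl divr_ge0 ?sqr_ge0// mulr_ge0// ltW.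
apply: le_trans (lee_wpmul2l _ H) _; first by rewrite lee_fin divr_ge0// ltW.
by rewrite -EFinM divfK.
Qed.

(** Integrating [f <= s / 2 + f^2 / (2 s)] takes the place of Jensen's inequality. *)
Lemma mean_le_of_second_moment (f : T -> R) (s : R) : measurable_fun setT f ->
  (forall om, 0 <= f om)%R -> (0 < s)%R ->
  \int[P]_om (f om ^+ 2)%:E <= (s ^+ 2)%:E -> \int[P]_om (f om)%:E <= s%:E.
Proof.
move=> mf f0 s0 H.
have mf2 : measurable_fun setT (fun om => (f om ^+ 2)%:E).
  by apply/measurable_EFinP; exact: measurable_funX.
apply: (@le_trans _ _ (\int[P]_om ((s / 2)%:E + (1 / (2 * s))%:E * (f om ^+ 2)%:E))).
  apply: ge0_le_integral => //.
  - by move=> om _; rewrite lee_fin.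
  - exact/measurable_EFinP.
  - by apply: emeasurable_funD => //; exact: emeasurable_funM.
  move=> om _; rewrite -EFinM -EFinD lee_fin.
  have -> : (s / 2 + 1 / (2 * s) * f om ^+ 2 = f om + (s - f om) ^+ 2 / (2 * s))%R.
    by field; rewrite gt_eqF.
  by rewrite lerDl divr_ge0 ?sqr_ge0// mulr_ge0// ltW.
have c0 : 0 <= (1 / (2 * s))%:E by rewrite lee_fin divr_ge0// mulr_ge0// ltW.
rewrite ge0_integralD//=; last 3 first.
- by move=> om _; rewrite lee_fin divr_ge0// ltW.
- by move=> om _; rewrite mule_ge0// lee_fin sqr_ge0.
- exact: emeasurable_funM.
rewrite ge0_integralZl//; last by move=> om _; rewrite lee_fin sqr_ge0.
rewrite integral_cst// [X in _ * X]probability_setT mule1.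
apply: le_trans (leeD2l _ (lee_wpmul2l c0 H)) _.
rewrite -EFinM -EFinD lee_fin le_eqVlt; apply/orP; left; apply/eqP.
by field; rewrite gt_eqF.
Qed.

Lemma psi2_norm_mean_le (f : T -> R) (eta : R) : measurable_fun setT f ->
  (forall om, 0 <= f om)%R -> psi2_norm P f <= eta%:E -> \int[P]_om (f om)%:E <= eta%:E.
Proof.
move=> mf f0; apply: le_trans; apply: le_ereal_inf_tmp => _ [s [s0 sH] <-].
exact: mean_le_of_exp_sqr.
Qed.

(** Testing the conditional expectation on the full space turns the almost sure bound into one on
    the plain exponential moment. *)
Lemma cond_psi2_mean_le n (G : set (set T)) (X : T -> 'cV[R]_n) (eta : R) :
  G setT -> G `<=` measurable -> measurable_fun setT X -> (0 < eta)%R ->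
  cond_psi2_le P G X eta -> \int[P]_om (norm2 (X om))%:E <= eta%:E.
Proof.
move=> GT Gm mX eta0 [Z [ZG Z0 ZE] Z2].
apply: mean_le_of_exp_sqr => //; first exact: measurable_norm2.
  by move=> om; exact: norm2_ge0.
rewrite -ZE//; apply: (@le_trans _ _ (\int[P]_om 2%:E)); last first.
  by rewrite integral_cst// [X in _ * X]probability_setT mule1.
apply: ae_ge0_le_integral => //.
- by move=> _ Y mY; rewrite setTI; apply/Gm/ZG; exists Y => //; rewrite setTI.
- by apply: filterS Z2 => om ? _.
Qed.

End mean_bounds.

Section history.
Context {d : measure_display} {T : measurableType d}.
Context {d1 : measure_display} {S1 : measurableType d1}.

Lemma g_sigma_algebra_preimage_sub (f : T -> S1) :
  measurable_fun setT f -> g_sigma_algebra_preimage f `<=` measurable.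
Proof. by move=> mf _ [Y mY <-]; exact: mf. Qed.

Lemma sigma_algebra_generatedT (G : set (set T)) : <<s G >> setT.
Proof. exact: (@measurableT _ (g_sigma_algebraType G)). Qed.

Lemma sigma_attack_measurable (x0 : T -> S1) (w : nat -> T -> S1) t :
  measurable_fun setT x0 -> (forall s, measurable_fun setT (w s)) ->
  sigma_attack x0 w t `<=` measurable.
Proof.
move=> mx mw; apply: smallest_sub; first exact: sigma_algebra_measurable.
move=> A [|[s _]]; first exact: g_sigma_algebra_preimage_sub.
exact: g_sigma_algebra_preimage_sub.
Qed.

End history.

(** * Measurability of states, outputs and iterates *)

Section iterate_measurability.
Context {R : realType} {n m r k : nat}.
Context {d : measure_display} {T : measurableType d}.
Variables (A : 'M[R]_n) (B : 'M[R]_(n, m)) (C : 'M[R]_(r, n)) (D : 'M[R]_(r, m)).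
Variables (x w : nat -> T -> 'cV[R]_n) (u : nat -> T -> 'cV[R]_m) (y : nat -> T -> 'cV[R]_r).
Hypothesis xE : forall t om, x t.+1 om = A *m x t om + B *m u t om + w t om.
Hypothesis yE : forall t om, y t om = C *m x t om + D *m u t om.
Variable tmax : nat.
Hypothesis mx0 : measurable_fun setT (x 0%N).
Hypothesis mw : forall s, (s < tmax)%N -> measurable_fun setT (w s).
Hypothesis mu : forall s, (s < tmax)%N -> measurable_fun setT (u s).

Lemma measurable_state t : (t <= tmax)%N -> measurable_fun setT (x t).
Proof.
elim: t => [//|t IH] tm; rewrite (funext (xE t)).
apply: measurable_mxD; last exact: mw.
by apply: measurable_mxD; apply: measurable_mulmx => //; [exact/IH/ltnW|exact: mu].
Qed.

Lemma measurable_output t : (t < tmax)%N -> measurable_fun setT (y t).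
Proof.
move=> tm; rewrite (funext (yE t)); apply: measurable_mxD; apply: measurable_mulmx => //.
  exact/measurable_state/ltnW.
exact: mu.
Qed.

Variables (rad : R) (gamma : nat -> R).
Variables (G g : nat -> T -> 'M[R]_(r, \sum_(j < k) m)).
Let U := input_window k u.
Hypothesis rad_ge0 : 0 <= rad.
Hypothesis mG0 : measurable_fun setT (G 0%N).
Hypothesis g_measurable : forall t, (k %| t)%N ->
  exists2 h : 'M[R]_(r, \sum_(j < k) m) * 'cV[R]_r * 'cV[R]_(\sum_(j < k) m) ->
              'M[R]_(r, \sum_(j < k) m),
    measurable_fun setT h &
    forall om, g t om = h (G t om, y (t + k - 1)%N om, U (t + k - 1)%N om).
Hypothesis G_step : forall t, (k %| t)%N -> forall om,
  is_frob_projection (frob_ball rad) (G t om - gamma t *: g t om) (G (t + k)%N om).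
Hypothesis k_gt0 : (0 < k)%N.

(** Attacks and inputs are assumed measurable before [tmax] only, and [T] is arbitrary: the
    statement serves both for the ambient sigma-algebra and for the one generated by the history. *)
Lemma measurable_iterate j : (j * k <= tmax)%N -> measurable_fun setT (G (j * k)%N).
Proof.
elim: j => [//|j IH]; rewrite mulSn addnC => jm.
have kj : (k %| j * k)%N by exact: dvdn_mull.
have tm : (j * k + k - 1 < tmax)%N by rewrite subn1 prednK// addn_gt0 k_gt0 orbT.
have mG : measurable_fun setT (G (j * k)%N) by apply: IH; exact: leq_trans (leq_addr _ _) jm.
have -> : G (j * k + k)%N =
    fun om => ball_proj rad (G (j * k)%N om - gamma (j * k)%N *: g (j * k)%N om).
  by apply/funext => om; apply: frob_projectionE => //; exact: G_step.
apply: measurable_ball_proj => //; apply: measurable_mxB => //; apply: measurable_mxZ => //.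
have [h mh gE] := g_measurable kj.
rewrite (funext gE); apply: (measurableT_comp mh).
apply: measurable_fun_pair; first by apply: measurable_fun_pair => //; exact: measurable_output.
apply: measurable_input_window => i _; apply: mu.
by rewrite (leq_ltn_trans _ tm)// leq_subr.
Qed.

End iterate_measurability.

Section generated_sigma_algebra.
Context {d : measure_display} {T : measurableType d}.
Context {d1 : measure_display} {S1 : measurableType d1}.
Variable G : set (set T).

Lemma measurable_generated (f : T -> S1) : g_sigma_algebra_preimage f `<=` <<s G >> ->
  measurable_fun setT (f : g_sigma_algebraType G -> S1).
Proof. by move=> Gf _ Y mY; apply: Gf; exists Y. Qed.

Lemma generated_preimage (f : T -> S1) (Y : set S1) :
  measurable_fun setT (f : g_sigma_algebraType G -> S1) -> measurable Y ->
  <<s G >> (f @^-1` Y).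
Proof. by move=> mf mY; rewrite -[X in <<s _ >> X]setTI; exact: mf. Qed.

End generated_sigma_algebra.

(** * Events of the future inputs and attack indicators *)

Section future.
Context {d : measure_display} {T : measurableType d} {R : realType}.

Lemma window_future m k (u : nat -> T -> 'cV[R]_m) t Y : (0 < k)%N -> measurable Y ->
  sigma_future u t (input_window k u (t + k - 1) @^-1` Y).
Proof.
move=> k0 mY; apply: generated_preimage => //; apply: measurable_input_window => j jk.
apply: measurable_generated => A Aj; apply: sub_sigma_algebra.
exists (t + k - 1 - j)%N => //=; rewrite -subnDA -addnBA ?leq_addr//.
Qed.

Lemma quiet_future (xi : nat -> T -> bool) t l :
  sigma_future xi t (\bigcap_(i in [set: 'I_l]) xi (t + i)%N @^-1` [set false]).
Proof.
set G := \bigcup_(s in [set s | (t <= s)%N]) g_sigma_algebra_preimage (xi s).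
suff : measurable (\bigcap_(i in [set: 'I_l])
    (xi (t + i)%N : g_sigma_algebraType G -> bool) @^-1` [set false]) by [].
apply: fin_bigcap_measurable => [|i _]; first exact: finite_finset.
rewrite -[X in measurable X]setTI; apply: (@measurable_generated _ _ _ _ G) => // A Ai.
by apply: sub_sigma_algebra; exists (t + i)%N => //=; rewrite leq_addr.
Qed.

Lemma quiet_probability (P : probability T R) (xi : nat -> {RV P >-> bool}) p t l :
  0 <= p <= 1 -> (forall t S, distribution P (xi t) S = bernoulli_prob p S) ->
  mutually_independent P (fun t => g_sigma_algebra_preimage (xi t)) ->
  P (\bigcap_(i in [set: 'I_l]) xi (t + i)%N @^-1` [set false]) = ((1 - p) ^+ l)%:E.
Proof.
move=> p01 xiB xiI.
have finj : injective (fun i : 'I_l => t + i)%N.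
  by move=> i j /addnI; exact: val_inj.
rewrite (mutually_independent_inj (E := fun i => xi (t + i)%N @^-1` [set false]) xiI finj).
  under eq_bigr => i _.
    rewrite (_ : P _ = (1 - p)%:E); first over.
    rewrite -[LHS]/(distribution P (xi (t + i)%N) [set false]) xiB bernoulli_probE//.
    by rewrite !diracE memNset//= mem_set//= mule0 add0e mule1.
  by rewrite prodEFin prodr_const card_ord.
by move=> i; exists [set false] => //; rewrite setTI.
Qed.

End future.

Section history_iterates.
Context {R : realType} {n m r k : nat}.
Context {d : measure_display} {T : measurableType d}.
Variables (A : 'M[R]_n) (B : 'M[R]_(n, m)) (C : 'M[R]_(r, n)) (D : 'M[R]_(r, m)).
Variables (x w : nat -> T -> 'cV[R]_n) (u : nat -> T -> 'cV[R]_m) (y : nat -> T -> 'cV[R]_r).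
Hypothesis xE : forall t om, x t.+1 om = A *m x t om + B *m u t om + w t om.
Hypothesis yE : forall t om, y t om = C *m x t om + D *m u t om.
Variables (rad : R) (gamma : nat -> R).
Variables (G g : nat -> T -> 'M[R]_(r, \sum_(j < k) m)).
Let U := input_window k u.
Hypothesis rad_ge0 : 0 <= rad.
Hypothesis G0E : forall om, G 0%N om = 0.
Hypothesis g_measurable : forall t, (k %| t)%N ->
  exists2 h : 'M[R]_(r, \sum_(j < k) m) * 'cV[R]_r * 'cV[R]_(\sum_(j < k) m) ->
              'M[R]_(r, \sum_(j < k) m),
    measurable_fun setT h &
    forall om, g t om = h (G t om, y (t + k - 1)%N om, U (t + k - 1)%N om).
Hypothesis G_step : forall t, (k %| t)%N -> forall om,
  is_frob_projection (frob_ball rad) (G t om - gamma t *: g t om) (G (t + k)%N om).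
Hypothesis k_gt0 : (0 < k)%N.

(** The measurability argument is rerun on [T] with the sigma-algebra of the history before
    [j * k]. *)
Lemma iterate_history j Y : measurable Y ->
  sigma_history (x 0%N) w u (j * k) (G (j * k)%N @^-1` Y).
Proof.
move=> mY; apply: generated_preimage => //.
set H := (_ `|` _).
apply: (@measurable_iterate _ _ _ _ _ _ (g_sigma_algebraType H) A B C D x w u y
  xE yE (j * k)%N _ _ _ rad gamma G g rad_ge0 _ g_measurable G_step k_gt0 j) => //.
- by apply: measurable_generated => S HS; apply: sub_sigma_algebra; left.
- by move=> s sj; apply: measurable_generated => S HS; apply: sub_sigma_algebra; right;
    exists s => //; left.
- by move=> s sj; apply: measurable_generated => S HS; apply: sub_sigma_algebra; right;
    exists s => //; right.
- by rewrite (funext G0E); exact: measurable_cst.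
Qed.

End history_iterates.

(** * Norm bounds for a stable system *)

Section state_bounds.
Context {R : realType}.

Lemma geometric_sum_le (rho : R) t : 0 <= rho -> rho < 1 ->
  \sum_(i < t) rho ^+ (t - i.+1) <= (1 - rho)^-1.
Proof.
move=> rho0 rho1; have r1 : 0 < 1 - rho by rewrite subr_gt0.
rewrite -[leRHS]mul1r ler_pdivlMr// (reindex_inj rev_ord_inj)/=.
under eq_bigr => i _ do rewrite subnSK// subKn 1?ltnW//.
have -> : (\sum_(i < t) rho ^+ i) * (1 - rho) = 1 - rho ^+ t.
  rewrite -[1 in RHS](expr1n _ t) subrXX mulrC; congr (_ * _).
  by apply: eq_bigr => i _; rewrite expr1n mul1r.
by rewrite gerBl exprn_ge0.
Qed.

Context {n m : nat} {T : Type}.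
Variables (A : 'M[R]_n) (B : 'M[R]_(n, m)).
Variables (x w : nat -> T -> 'cV[R]_n) (u : nat -> T -> 'cV[R]_m).
Hypothesis xE : forall t om, x t.+1 om = A *m x t om + B *m u t om + w t om.
Variables (psi rho : R).
Hypothesis psi_ge0 : 0 <= psi.
Hypothesis rho_ge0 : 0 <= rho.
Hypothesis stable : forall t, spectral_norm (A ^+ t) <= psi * rho ^+ t.

Lemma pow_norm_le t (v : 'cV[R]_n) : norm2 (A ^+ t *m v) <= psi * rho ^+ t * norm2 v.
Proof.
by apply: le_trans (spectral_normP _ _) _; rewrite ler_wpM2r ?norm2_ge0.
Qed.

Lemma state_norm_le t om : norm2 (x t om) <= psi * rho ^+ t * norm2 (x 0%N om) +
  \sum_(i < t) psi * rho ^+ (t - i.+1) *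
    (spectral_norm B * norm2 (u i om) + norm2 (w i om)).
Proof.
have := state_unroll xE 0 t om; rewrite add0n => ->.
apply: le_trans (norm2D _ _) (lerD (pow_norm_le _ _) _).
rewrite norm2E; apply: le_trans (frob_norm_sum _ _ _) _; apply: ler_sum => i _.
rewrite -norm2E add0n; apply: le_trans (pow_norm_le _ _) _.
rewrite ler_wpM2l ?mulr_ge0 ?exprn_ge0//; apply: le_trans (norm2D _ _) _.
by rewrite lerD2r spectral_normP.
Qed.

End state_bounds.

(** * The expected one-step inequality *)

Section state_mean.
Context {R : realType} {n m : nat}.
Context {d : measure_display} {T : measurableType d} (P : probability T R).
Variables (A : 'M[R]_n) (B : 'M[R]_(n, m)).
Variables (x w : nat -> T -> 'cV[R]_n) (u : nat -> T -> 'cV[R]_m).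
Hypothesis xE : forall t om, x t.+1 om = A *m x t om + B *m u t om + w t om.
Variables (psi rho eta mu : R).
Hypothesis psi_ge0 : 0 <= psi.
Hypothesis rho_ge0 : 0 <= rho.
Hypothesis rho_lt1 : rho < 1.
Hypothesis eta_ge0 : 0 <= eta.
Hypothesis mu_ge0 : 0 <= mu.
Hypothesis stable : forall t, spectral_norm (A ^+ t) <= psi * rho ^+ t.
Hypothesis mx : forall t, measurable_fun setT (x t).
Hypothesis mw : forall t, measurable_fun setT (w t).
Hypothesis m_u : forall t, measurable_fun setT (u t).
Local Open Scope ereal_scope.
Hypothesis x0_mean : \int[P]_om (norm2 (x 0%N om))%:E <= eta%:E.
Hypothesis w_mean : forall t, \int[P]_om (norm2 (w t om))%:E <= eta%:E.
Hypothesis u_mean : forall t, \int[P]_om (norm2 (u t om))%:E <= mu%:E.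

Lemma state_mean_le t : \int[P]_om (norm2 (x t om))%:E <=
  (2 * psi / (1 - rho) * (eta + spectral_norm B * mu))%:E.
Proof.
have B0 := spectral_norm_ge0 B.
have mn k (f : T -> 'cV[R]_k) : measurable_fun setT f ->
    measurable_fun setT (fun om => (norm2 (f om))%:E).
  by move=> mf; apply/measurable_EFinP; exact: measurable_norm2.
have n0 k (f : T -> 'cV[R]_k) om : 0 <= (norm2 (f om))%:E by rewrite lee_fin norm2_ge0.
have r0 l : (0 <= psi * rho ^+ l)%R by rewrite mulr_ge0// exprn_ge0.
pose h i om := (spectral_norm B)%:E * (norm2 (u i om))%:E + (norm2 (w i om))%:E.
have mh i : measurable_fun setT (h i).
  by apply: emeasurable_funD; [apply: emeasurable_funM => //|]; exact: mn.
have h0 i om : 0 <= h i om by rewrite adde_ge0// mule_ge0.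
have hint i : \int[P]_om h i om <= (eta + spectral_norm B * mu)%:E.
  rewrite ge0_integralD//; [|by move=> om _; rewrite mule_ge0
    |by apply: emeasurable_funM => //; exact: mn|exact: mn].
  rewrite ge0_integralZl//; last exact: mn.
  by rewrite addeC EFinD EFinM leeD// lee_wpmul2l.
apply: (@le_trans _ _ (\int[P]_om ((psi * rho ^+ t)%:E * (norm2 (x 0%N om))%:E +
   \sum_(i < t) (psi * rho ^+ (t - i.+1))%:E * h i om))).
  apply: ge0_le_integral => //; first exact: mn.
  - apply: emeasurable_funD; first by apply: emeasurable_funM => //; exact: mn.
    by apply: emeasurable_sum => i; exact: emeasurable_funM.
  move=> om _.
  rewrite (_ : \sum_(i < t) _ = (\sum_(i < t) psi * rho ^+ (t - i.+1) *
    (spectral_norm B * norm2 (u i om) + norm2 (w i om)))%:E); last first.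
    by rewrite -sumEFin; apply: eq_bigr => i _; rewrite [RHS]EFinM [X in _ = _ * X]EFinD EFinM.
  rewrite -EFinM -EFinD lee_fin; exact: (state_norm_le xE).
rewrite ge0_integralD//; last 4 first.
- by move=> om _; rewrite mule_ge0// lee_fin.
- by apply: emeasurable_funM => //; exact: mn.
- by move=> om _; apply: sume_ge0 => i _; rewrite mule_ge0// lee_fin.
- by apply: emeasurable_sum => i; exact: emeasurable_funM.
rewrite ge0_integralZl//; [|exact: mn|by rewrite lee_fin].
rewrite ge0_integral_sum//; last 2 first.
- by move=> i; exact: emeasurable_funM.
- by move=> i om _; rewrite mule_ge0// lee_fin.
set c := (eta + _)%R in hint *.
have c0 : (0 <= c)%R by rewrite addr_ge0// mulr_ge0.
(* The bounds [rho^t <= 1 <= 1 / (1 - rho)] and [eta <= c] give the initial state the same estimate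
   as the whole sum, whence the factor 2. *)
have s1 : (psi * rho ^+ t)%:E * \int[P]_om (norm2 (x 0%N om))%:E <= (psi / (1 - rho) * c)%:E.
  apply: le_trans (lee_wpmul2l _ x0_mean) _; first by rewrite lee_fin.
  rewrite -EFinM lee_fin; apply: ler_pM => //.
    rewrite ler_wpM2l// (@le_trans _ _ 1)%R//; first by rewrite exprn_ile1// ltW.
    by rewrite invf_ge1 ?subr_gt0// gerBl.
  by rewrite lerDl mulr_ge0.
have s2 : \sum_(i < t) \int[P]_om ((psi * rho ^+ (t - i.+1))%:E * h i om) <=
    (psi / (1 - rho) * c)%:E.
  apply: (@le_trans _ _ (\sum_(i < t) (psi * rho ^+ (t - i.+1) * c)%:E)).
    apply: lee_sum => i _; rewrite ge0_integralZl//; last by rewrite lee_fin.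
    by rewrite [leRHS]EFinM; apply: lee_wpmul2l => //; rewrite lee_fin.
  rewrite sumEFin lee_fin -mulr_suml ler_wpM2r// -mulr_sumr ler_wpM2l//.
  exact: geometric_sum_le.
apply: le_trans (leeD s1 s2) _.
rewrite -EFinD lee_fin; rewrite le_eqVlt; apply/orP; left; apply/eqP.
by ring.
Qed.

End state_mean.

(** * Excess loss with and without attack *)

Section excess_loss.
Context {R : realType} {r N : nat}.
Variables (y z v : 'cV[R]_r) (U : 'cV[R]_N) (G Gs : 'M[R]_(r, N)).
Hypothesis yE : y - Gs *m U = z + v.
Let f (H : 'M[R]_(r, N)) := norm2 (y - H *m U).

Let fE : f G = norm2 (z + v - (G - Gs) *m U).
Proof. by rewrite /f -yE mulmxBl opprB addrA subrK. Qed.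

(** Here [f Gs = |z|] and [f G = |z - (G - Gs) U| >= |(G - Gs) U| - |z|]. *)
Lemma excess_loss_quiet : v = 0 ->
  norm2 ((G - Gs) *m U) - 2 * norm2 z <= f G - f Gs.
Proof.
move=> v0; rewrite fE /f yE v0 addr0.
have := norm2B z (z - (G - Gs) *m U); rewrite opprB addrC subrK.
by lra.
Qed.

Lemma excess_loss_attacked : - norm2 ((G - Gs) *m U) <= f G - f Gs.
Proof.
rewrite fE /f yE; have := norm2D (z + v - (G - Gs) *m U) ((G - Gs) *m U).
by rewrite subrK; lra.
Qed.

End excess_loss.

Section expected_step.
Context {d : measure_display} {T : measurableType d} {R : realType}.
Variable P : probability T R.
Local Open Scope ereal_scope.

(** The gain on [S] stays on the left and the loss off [S] on the right, so that only nonnegative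
    functions are integrated; the weights [1 - q] and [q] combine to [1 - 2 q]. *)
Lemma expected_step (S : set T) (a' a h b : T -> R) (c q W al be : R) :
  measurable S ->
  measurable_fun setT a' -> measurable_fun setT a ->
  measurable_fun setT h -> measurable_fun setT b ->
  (forall om, 0 <= a' om)%R -> (forall om, 0 <= a om)%R ->
  (forall om, 0 <= h om)%R -> (forall om, 0 <= b om)%R -> (0 <= c)%R ->
  (forall om, S om -> a' om + c * h om <= a om + b om)%R ->
  (forall om, ~ S om -> a' om <= a om + c * h om + b om)%R ->
  \int[P]_(om in S) (h om)%:E = ((1 - q) * W)%:E ->
  \int[P]_(om in ~` S) (h om)%:E = (q * W)%:E ->
  \int[P]_om (a om)%:E = al%:E -> \int[P]_om (b om)%:E <= be%:E ->
  \int[P]_om (a' om)%:E <= (al - c * (1 - 2 * q) * W + be)%:E.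
Proof.
move=> mS ma' ma mh mb a'0 a0 h0 b0 c0 HS HnS IS InS Ia Ib.
pose hS := (EFin \o h) \_ S; pose hC := (EFin \o h) \_ (~` S).
have mhS : measurable_fun setT hS.
  by apply/(measurable_restrictT _ mS)/measurable_funTS/measurable_EFinP.
have mhC : measurable_fun setT hC.
  apply/(measurable_restrictT _ (measurableC mS))/measurable_funTS.
  exact/measurable_EFinP.
have hS0 om : 0 <= hS om by apply: erestrict_ge0 => ? _; rewrite lee_fin.
have hC0 om : 0 <= hC om by apply: erestrict_ge0 => ? _; rewrite lee_fin.
have c0' : 0 <= c%:E by rewrite lee_fin.
have EmF (f : T -> R) : measurable_fun setT f -> measurable_fun setT (fun om => (f om)%:E).
  by move=> mf; exact/measurable_EFinP.
have : \int[P]_om ((a' om)%:E + c%:E * hS om) <=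
    \int[P]_om ((a om)%:E + c%:E * hC om + (b om)%:E).
  apply: ge0_le_integral => //.
  - by move=> om _; rewrite adde_ge0 ?mule_ge0// lee_fin.
  - by apply: emeasurable_funD; [exact: EmF|exact: emeasurable_funM].
  - apply: emeasurable_funD; [|exact: EmF].
    by apply: emeasurable_funD; [exact: EmF|exact: emeasurable_funM].
  move=> om _; rewrite /hS /hC !patchE in_setC.
  have [/set_mem Som|/negP nSom] := boolP (om \in S).
    by rewrite mule0 adde0 -EFinM -!EFinD lee_fin HS.
  rewrite mule0 adde0 -EFinM -!EFinD lee_fin HnS// => Som; apply: nSom.
  exact: mem_set.
rewrite ge0_integralD//; last 4 first.
- by move=> om _; rewrite lee_fin.
- exact: EmF.
- by move=> om _; rewrite mule_ge0.
- exact: emeasurable_funM.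
rewrite ge0_integralZl// -integral_mkcond IS.
rewrite ge0_integralD//; last 4 first.
- by move=> om _; rewrite adde_ge0 ?mule_ge0// lee_fin.
- by apply: emeasurable_funD; [exact: EmF|exact: emeasurable_funM].
- by move=> om _; rewrite lee_fin.
- exact: EmF.
rewrite ge0_integralD//; last 4 first.
- by move=> om _; rewrite lee_fin.
- exact: EmF.
- by move=> om _; rewrite mule_ge0.
- exact: emeasurable_funM.
rewrite ge0_integralZl// -integral_mkcond InS Ia -!EFinM -EFinD.
move=> /le_trans/(_ (leeD2l _ Ib)); set I := \int[P]_om (a' om)%:E.
have : 0 <= I by apply: integral_ge0 => om _; rewrite lee_fin.
case: I => [I| |]//.
by rewrite -!EFinD !lee_fin => _ H; lra.
Qed.

End expected_step.

Lemma bernoulli_inequality (R : realDomainType) (p : R) l : 0 <= p <= 1 ->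
  1 - l%:R * p <= (1 - p) ^+ l.
Proof.
move=> /andP[p0 p1]; elim: l => [|l IH]; first by rewrite mul0r subr0 expr0.
rewrite exprS -natr1; have p1' : 0 <= 1 - p by rewrite subr_ge0.
apply: le_trans (ler_wpM2l p1' IH).
have : 0 <= l%:R * p * p by rewrite !mulr_ge0.
by lra.
Qed.

(** Bernoulli's inequality gives [(1 - p)^l >= 1 - l p > 1/2]. *)
Lemma attack_probability_lt (R : realFieldType) (p : R) l : (0 < l)%N ->
  0 <= p -> p < 1 / (2 * l%:R) -> p <= 1 /\ 0 < 1 - 2 * (1 - (1 - p) ^+ l).
Proof.
move=> l0 p0; have lp : 1 <= l%:R :> R by rewrite ler1n.
rewrite ltr_pdivlMr ?mulr_gt0 ?(lt_le_trans ltr01 lp)// => pl.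
have p1 : p <= 1.
  have : p * 2 <= p * (2 * l%:R) by rewrite ler_wpM2l// ler_peMr.
  by lra.
have := @bernoulli_inequality _ p l; rewrite p0 p1 => /(_ isT).
by split=> //; lra.
Qed.

(** * Constants of the recursion *)

Section rates.
Context {R : realType}.
Variables (rad sigma beta s : R).
Hypothesis rad_gt0 : 0 < rad.
Hypothesis sigma_gt0 : 0 < sigma.
Hypothesis s_gt0 : 0 < s.
Hypothesis s_le1 : s <= 1.
Hypothesis beta_gt : Num.sqrt (2 * pi) * rad / (s * sigma) < beta.
Let c := beta * s * sigma / (Num.sqrt (2 * pi) * rad).

Let sp_gt0 : 0 < Num.sqrt (2 * pi) :> R.
Proof. by rewrite sqrtr_gt0 mulr_gt0// pi_gt0. Qed.

Lemma contraction_gt1 : 1 < c.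
Proof.
by rewrite /c ltr_pdivlMr ?mulr_gt0// mul1r -mulrA -ltr_pdivrMr ?mulr_gt0.
Qed.

(** Provides the a priori hypothesis of [robbins_monro_rate]. From [j + 1 < c] follows
    [j + 2 <= 2 c], while [pi >= 2], [l >= 2] and [s <= 1] make the lower bound on [E] at least
    [8 c rad^2]. *)
Lemma diameter_le (l j : nat) (E : R) : (2 <= l)%N ->
  beta ^+ 2 * sigma ^+ 2 * l%:R / (c - 1) <= E -> j.+1%:R < c ->
  4 * rad ^+ 2 <= E / j.+2%:R.
Proof.
move=> l2 EM jc; have c1 := contraction_gt1.
have pi2 : 2 <= pi :> R by exact: pi_ge2.
have l2' : 2 <= l%:R :> R by rewrite (ler_nat _ 2).
rewrite ler_pdivlMr ?ltr0n//; apply: le_trans EM; rewrite ler_pdivlMr ?subr_gt0//.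
have -> : beta ^+ 2 * sigma ^+ 2 * l%:R = c ^+ 2 * (2 * pi) * rad ^+ 2 / s ^+ 2 * l%:R.
  rewrite -[X in _ = c ^+ 2 * X * _ / _ * _](@sqr_sqrtr _ (2 * pi)) ?mulr_ge0 ?pi_ge0//.
  by rewrite /c; field; rewrite !gt_eqF//.
have j2 : j.+2%:R <= 2 * c by rewrite -natr1; lra.
have r0 := ltW rad_gt0; have r2 : 0 <= rad ^+ 2 by exact: sqr_ge0.
have c0 : 0 <= c by exact: ltW (lt_trans ltr01 c1).
apply: (@le_trans _ _ (4 * rad ^+ 2 * (2 * c) * c)).
  apply: ler_pM => //; [by rewrite !mulr_ge0//|by rewrite subr_ge0 ltW| |by lra].
  by rewrite ler_wpM2l// mulr_ge0.
have i1 : 1 <= (s ^+ 2)^-1 by rewrite invf_ge1 ?exprn_gt0// exprn_ile1// ltW.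
have p0 : 0 <= c ^+ 2 * (2 * 2) * rad ^+ 2.
  by apply: mulr_ge0 => //; apply: mulr_ge0; rewrite ?sqr_ge0// mulr_ge0.
have -> : 4 * rad ^+ 2 * (2 * c) * c = c ^+ 2 * (2 * 2) * rad ^+ 2 * 1 * 2 by ring.
have c2 : 0 <= c ^+ 2 by exact: sqr_ge0.
apply: ler_pM => //; first by rewrite mulr1.
apply: ler_pM => //.
by rewrite ler_wpM2r// ler_wpM2l// ler_wpM2l.
Qed.

End rates.

(** * The mean prediction gap of an iterate *)

Section gap.
Context {d : measure_display} {T : measurableType d} {R : realType}.
Variable P : probability T R.
Local Open Scope ereal_scope.

(** The double integral does not depend on [S]: the gap has the same conditional mean on and off the
    attack-free event. *)
Lemma gap_integral r N (U : {RV P >-> 'cV[R]_N}) (X : {RV P >-> 'M[R]_(r, N)}) S :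
  measurable S ->
  (forall A B, measurable A -> measurable B ->
     P (S `&` (U @^-1` A `&` X @^-1` B)) = P S * (P (U @^-1` A) * P (X @^-1` B))) ->
  \int[P]_(om in S) (norm2 (X om *m U om))%:E =
  P S * \int[distribution P X]_M \int[distribution P U]_v (norm2 (M *m v))%:E.
Proof.
move=> mS indep.
apply: (@ge0_integral_independent _ _ _ _ _ _ _ P U X S
  (fun z => (norm2 (z.2 *m z.1))%:E)) => //; last by move=> z; rewrite lee_fin norm2_ge0.
by apply/measurable_EFinP/measurable_norm2; apply: measurable_mulmx.
Qed.

(** The bound [L] turns a first power into a square, [|X| >= |X|^2 / L], which closes the recursion
    in the mean squared error. *)
Lemma gap_ge r N (U : {RV P >-> 'cV[R]_N}) (X : {RV P >-> 'M[R]_(r, N)}) (ka L : R) :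
  (0 < ka)%R -> (0 < L)%R -> (forall om, frob_norm (X om) <= L)%R ->
  (forall M : 'M[R]_(r, N),
     (ka * frob_norm M)%:E <= \int[distribution P U]_v (norm2 (M *m v))%:E) ->
  (ka / L)%:E * \int[P]_om (frob_norm (X om) ^+ 2)%:E <=
  \int[distribution P X]_M \int[distribution P U]_v (norm2 (M *m v))%:E.
Proof.
move=> ka0 L0 XL H.
have mX : measurable_fun setT (fun om => frob_norm (X om)).
  by apply: measurable_frob_norm.
rewrite -ge0_integralZl//; last 3 first.
- by apply/measurable_EFinP; exact: measurable_funX.
- by move=> om _; rewrite lee_fin sqr_ge0.
- by rewrite lee_fin divr_ge0// ltW.
apply: (@le_trans _ _ (\int[P]_om (ka * frob_norm (X om))%:E)).
  apply: ge0_le_integral => //.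
  - by move=> om _; rewrite mule_ge0// lee_fin ?sqr_ge0// divr_ge0// ltW.
  - by apply: emeasurable_funM => //; apply/measurable_EFinP; exact: measurable_funX.
  - by apply/measurable_EFinP; exact: measurable_funM.
  move=> om _; rewrite -EFinM lee_fin -mulrA ler_wpM2l ?(ltW ka0)//.
  by rewrite mulrC ler_pdivrMr// expr2 ler_wpM2l// frob_norm_ge0.
have mka : measurable_fun setT (fun M : 'M[R]_(r, N) => (ka * frob_norm M)%:E).
  apply/measurable_EFinP; apply: measurable_funM => //; exact: measurable_frob_norm.
have ka0' (M : 'M[R]_(r, N)) : 0 <= (ka * frob_norm M)%:E.
  by rewrite lee_fin mulr_ge0 ?frob_norm_ge0// ltW.
rewrite -(ge0_integral_distribution X (f := fun M => (ka * frob_norm M)%:E))//.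
apply: ge0_le_integral => //.
apply: (@measurable_fun_fubini_tonelli_G _ _ _ _ _ (distribution P U)
  (fun z : 'cV[R]_N * 'M[R]_(r, N) => (norm2 (z.2 *m z.1))%:E)).
  by apply/measurable_EFinP/measurable_norm2; apply: measurable_mulmx.
by move=> z; rewrite lee_fin norm2_ge0.
Qed.

Lemma independent_triple (F1 F2 F3 : set (set T)) S1 S2 S3 :
  mutually_independent P (tnth [tuple F1; F2; F3]) -> F1 S1 -> F2 S2 -> F3 S3 ->
  P (S2 `&` (S1 `&` S3)) = P S2 * (P S1 * P S3).
Proof.
move=> indep h1 h2 h3.
have := @mutually_independent_inj _ _ _ P _ _ 3 id (tnth [tuple S1; S2; S3]) indep
  (@inj_id _).
rewrite 3!big_ord_recl big_ord0 mule1 /tnth/=.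
rewrite (_ : \bigcap_(j in _) _ = S2 `&` (S1 `&` S3)); last first.
  apply/seteqP; split => [om H|om [? [? ?]] [[|[|[|//]]] ?] _]//.
  split; first by have := H (@Ordinal 3 1 isT) I.
  split; first by have := H (@Ordinal 3 0 isT) I.
  by have := H (@Ordinal 3 2 isT) I.
move=> ->; first by rewrite muleCA.
by move=> [[|[|[|//]]] ?].
Qed.

End gap.

Section step_bounds.
Context {R : realDomainType}.
Variables (a' a ga f h z v : R).
Hypothesis ga_ge0 : 0 <= ga.

Lemma quiet_step_bound : a' <= a - 2 * ga * f + v -> h - 2 * z <= f ->
  a' + 2 * ga * h <= a + (4 * ga * z + v).
Proof. by move=> H /(ler_wpM2l ga_ge0); lra. Qed.

Lemma attacked_step_bound : 0 <= z -> a' <= a - 2 * ga * f + v -> - h <= f ->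
  a' <= a + 2 * ga * h + (4 * ga * z + v).
Proof. by move=> /(mulr_ge0 ga_ge0) Hz H /(ler_wpM2l ga_ge0); lra. Qed.

End step_bounds.

(** * The convergence rate *)

Theorem theorem4 (R : realType) (psi : R) (psi_gt0 : 0 < psi) :
  exists2 K : R, 0 < K &
  forall (n m r k : nat) (n_gt0 : (0 < n)%N) (m_gt0 : (0 < m)%N)
    (r_gt0 : (0 < r)%N) (k_ge2 : (2 <= k)%N)
    (A : 'M[R]_n) (B : 'M[R]_(n, m)) (C : 'M[R]_(r, n)) (D : 'M[R]_(r, m))
    (d : measure_display) (T : measurableType d) (P : probability T R)
    (x w : nat -> {RV P >-> 'cV[R]_n}) (u : nat -> {RV P >-> 'cV[R]_m})
    (y : nat -> {RV P >-> 'cV[R]_r})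
    (xE : forall t om, x t.+1 om = A *m x t om + B *m u t om + w t om)
    (yE : forall t om, y t om = C *m x t om + D *m u t om)
    (xi : nat -> {RV P >-> bool})
    (rho eta p sigma rad beta : R),
  let Gstar := markov_matrix k A B C D in
  let U := input_window k u in
  let F := sigma_attack (x 0%N) w in
  forall
    (* interplay of randomness *)
    (indep : forall t, mutually_independent P
       (tnth [tuple sigma_future u t; sigma_future xi t;
                    sigma_history (x 0%N) w u t]))
    (* (i) *)
    (rho_ge0 : 0 <= rho) (rho_lt1 : rho < 1)
    (stable : forall t, spectral_norm (A ^+ t) <= psi * rho ^+ t)
    (* (ii) *)
    (eta_gt0 : 0 < eta)
    (x0_psi2 : (psi2_norm P (fun om => norm2 (x 0%N om)) <= eta%:E)%E)
    (w_psi2 : forall t, cond_psi2_le P (F t) (w t) eta)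
    (* (iii) *)
    (p_ge0 : 0 <= p) (p_lt : p < 1 / (2 * (k - 1)%:R))
    (xi_bernoulli : forall t S, distribution P (xi t) S = bernoulli_prob p S)
    (xi_indep : mutually_independent P
       (fun t => g_sigma_algebra_preimage (xi t)))
    (xi_indep_F : forall t, mutually_independent P
       (tnth [tuple g_sigma_algebra_preimage (xi t); F t]))
    (xi_w : forall t, [set om | xi t om = false] `<=` [set om | w t om = 0])
    (* (iv) *)
    (sigma_gt0 : 0 < sigma)
    (u_indep : mutually_independent P (fun t => g_sigma_algebra_preimage (u t)))
    (u_gaussian : forall t, isotropic_gaussian sigma (u t))
    (* (v) *)
    (rad_gt0 : 0 < rad) (Gstar_le : frob_norm Gstar <= rad),
  let q := 1 - (1 - p) ^+ (k - 1) in
  let nu := spectral_norm C / (1 - 2 * q) *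
            (eta / sigma + Num.sqrt m%:R * spectral_norm B) in
  forall
    (beta_gt : Num.sqrt (2 * pi) * rad / ((1 - 2 * q) * sigma) < beta)
    (G g : nat -> T -> 'M[R]_(r, \sum_(j < k) m)),
  let f t om H := norm2 (y (t + k - 1)%N om - H *m U (t + k - 1)%N om) in
  let gamma t : R := k%:R * beta / (t + k)%:R in
  let G0 : 'M[R]_(r, \sum_(j < k) m) := 0 in
  forall
    (G_init : forall om, G 0%N om = G0)
    (g_subgrad : forall t, (k %| t)%N ->
       forall om, subdifferential (f t om) (G t om) (g t om))
    (g_measurable : forall t, (k %| t)%N ->
       exists2 h : 'M[R]_(r, \sum_(j < k) m) * 'cV[R]_r *
                   'cV[R]_(\sum_(j < k) m) -> 'M[R]_(r, \sum_(j < k) m),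
         measurable_fun setT h &
         forall om, g t om = h (G t om, y (t + k - 1)%N om, U (t + k - 1)%N om))
    (G_step : forall t, (k %| t)%N -> forall om,
       is_frob_projection (frob_ball rad) (G t om - gamma t *: g t om)
         (G (t + k)%N om)),
  let E := Num.max (frob_norm (G0 - Gstar) ^+ 2)
             (beta ^+ 2 * sigma ^+ 2 * (m * k)%:R /
              (beta * (1 - 2 * q) * sigma / (Num.sqrt (2 * pi) * rad) - 1)) in
  forall t, (k %| t)%N ->
  ('E_P[fun om => (frob_norm (G t om - Gstar) ^+ 2)%R] <=
    (K * (rho ^+ (k - 1) * nu / (1 - rho) *
            (rad * Num.sqrt (m * k)%:R / (1 - 2 * q) +
             rho ^+ (k - 1) * nu / (1 - rho)) +
          k%:R * E / (t + k)%:R))%:E)%E.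
Proof.
have sp_gt0 : 0 < Num.sqrt (2 * pi) :> R by rewrite sqrtr_gt0 mulr_gt0// pi_gt0.
(* The summand 1 serves the term in [E]; the other one is the constant of [bias] below. *)
exists (1 + 8 * psi ^+ 2 * Num.sqrt (2 * pi)).
  by rewrite ltr_wpDr// mulr_ge0 ?mulr_ge0 ?sqr_ge0// ltW.
move=> n m r k n_gt0 m_gt0 r_gt0 k_ge2 A B C D d T P x w u y xE yE xi.
move=> rho eta p sigma rad beta Gstar U F indep rho_ge0 rho_lt1 stable eta_gt0.
move=> x0_psi2 w_psi2 p_ge0 p_lt xi_bernoulli xi_indep xi_indep_F xi_w sigma_gt0.
move=> u_indep u_gaussian rad_gt0 Gstar_le q nu beta_gt G g f gamma G0 G_init.
move=> g_subgrad g_measurable G_step E.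
have k_gt0 : (0 < k)%N by exact: ltnW.
have k1_gt0 : (0 < k - 1)%N by rewrite subn_gt0.
have [p_le1 s_gt0] := attack_probability_lt k1_gt0 p_ge0 p_lt.
rewrite -/q in s_gt0.
have q_ge0 : 0 <= q.
  by rewrite subr_ge0 exprn_ile1 ?subr_ge0// gerBl.
have s_le1 : 1 - 2 * q <= 1 by rewrite gerBl mulr_ge0.
have psi_ge0 := ltW psi_gt0; have rad_ge0 := ltW rad_gt0.
have C0 := spectral_norm_ge0 C; have B0 := spectral_norm_ge0 B.
have r1_gt0 : 0 < 1 - rho by rewrite subr_gt0.
have beta_gt0 : 0 < beta.
  by apply: lt_trans beta_gt; rewrite divr_gt0 ?mulr_gt0.
have mx t : measurable_fun setT (x t) by exact: measurable_funPT.
have mw t : measurable_fun setT (w t) by exact: measurable_funPT.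
have m_u t : measurable_fun setT (u t) by exact: measurable_funPT.
have x0_mean : (\int[P]_om (norm2 (x 0%N om))%:E <= eta%:E)%E.
  apply: psi2_norm_mean_le => //; first exact: measurable_norm2.
  by move=> om; exact: norm2_ge0.
have w_mean t : (\int[P]_om (norm2 (w t om))%:E <= eta%:E)%E.
  apply: (@cond_psi2_mean_le _ _ _ P _ (F t)) => //.
    exact: sigma_algebra_generatedT.
  exact: sigma_attack_measurable.
have sm_gt0 : 0 < Num.sqrt m%:R * sigma by rewrite mulr_gt0// sqrtr_gt0 ltr0n.
have u_mean t : (\int[P]_om (norm2 (u t om))%:E <= (Num.sqrt m%:R * sigma)%:E)%E.
  apply: mean_le_of_second_moment => //; first exact: measurable_norm2.
    by move=> om; exact: norm2_ge0.
  rewrite exprMn sqr_sqrtr ?ler0n//; exact: isotropic_second_moment.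
have x_mean t := state_mean_le xE psi_ge0 rho_ge0 rho_lt1 (ltW eta_gt0) (ltW sm_gt0)
  stable mx mw m_u x0_mean w_mean u_mean t.
pose s := 1 - 2 * q; rewrite -/s in s_gt0 s_le1.
(* [Z] bounds the mean norm of [C A^(k-1) x_t] uniformly in [t]. One factor [psi] comes from
   [A^(k-1)], the other from the bound on the state. *)
pose Z := spectral_norm C * (psi * rho ^+ (k - 1) *
  (2 * psi / (1 - rho) * (eta + spectral_norm B * (Num.sqrt m%:R * sigma)))).
have z_mean t : (\int[P]_om (norm2 (C *m (A ^+ (k - 1) *m x t om)))%:E <= Z%:E)%E.
  have c0 : 0 <= spectral_norm C * (psi * rho ^+ (k - 1)).
    by rewrite mulr_ge0// mulr_ge0// exprn_ge0.
  apply: (@le_trans _ _ (\int[P]_om ((spectral_norm C * (psi * rho ^+ (k - 1)))%:E *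
      (norm2 (x t om))%:E))%E).
    apply: ge0_le_integral => //.
    - by move=> om _; rewrite lee_fin norm2_ge0.
    - by apply/measurable_EFinP/measurable_norm2; do 2 apply: measurable_mulmx => //.
    - by apply: emeasurable_funM => //; apply/measurable_EFinP; exact: measurable_norm2.
    move=> om _; rewrite -EFinM lee_fin -mulrA.
    apply: le_trans (spectral_normP _ _) _.
    by rewrite ler_wpM2l//; exact: pow_norm_le.
  rewrite ge0_integralZl//; last 2 first.
  - by apply/measurable_EFinP; exact: measurable_norm2.
  - by move=> om _; rewrite lee_fin norm2_ge0.
  rewrite (_ : Z%:E = ((spectral_norm C * (psi * rho ^+ (k - 1)))%:E * (2 * psi /
    (1 - rho) * (eta + spectral_norm B * (Num.sqrt m%:R * sigma)))%:E)%E).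
    by apply: lee_wpmul2l => //; rewrite lee_fin.
  by rewrite -EFinM /Z mulrA.
have kdvd j : (k %| j * k)%N by exact: dvdn_mull.
have mG j : measurable_fun setT (G (j * k)%N).
  apply: (@measurable_iterate _ _ _ _ _ _ _ A B C D x w u y xE yE (j * k)%N _ _ _ rad
    gamma G g rad_ge0 _ g_measurable G_step k_gt0 j) => //.
  by rewrite (funext G_init); exact: measurable_cst.
have G_le j om : frob_norm (G (j * k)%N om) <= rad.
  case: j => [|j]; first by rewrite mul0n G_init frob_norm0.
  by rewrite mulSn addnC; have [] := G_step _ (kdvd j) om.
have mDl j : measurable_fun setT (fun om => G (j * k)%N om - Gstar).
  exact: measurable_mxB.
pose Dl j : {RV P >-> 'M[R]_(r, \sum_(j < k) m)} :=
  HB.pack (fun om => G (j * k)%N om - Gstar) (isMeasurableFun.Build _ _ _ _ _ (mDl j)).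
have mU j : measurable_fun setT (U (j * k + k - 1)%N).
  by apply: measurable_input_window.
pose V j : {RV P >-> 'cV[R]_(\sum_(j < k) m)} :=
  HB.pack (U (j * k + k - 1)%N) (isMeasurableFun.Build _ _ _ _ _ (mU j)).
have Dl_le j om : frob_norm (Dl j om) <= 2 * rad.
  by apply: le_trans (frob_normB _ _) _; rewrite mulrDl mul1r lerD.
pose a j om := frob_norm (Dl j om) ^+ 2.
have ma j : measurable_fun setT (a j).
  by apply: measurable_funX; exact: measurable_frob_norm.
have a_ge0 j om : 0 <= a j om by exact: sqr_ge0.
have a_le j om : a j om <= 4 * rad ^+ 2.
  rewrite (_ : 4 * rad ^+ 2 = (2 * rad) ^+ 2); last by ring.
  by rewrite ler_sqr ?nnegrE ?frob_norm_ge0// mulr_ge0.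
(* The errors are bounded, so the means are finite and [fine] loses nothing. *)
pose al j := fine (\int[P]_om (a j om)%:E).
have Ia_le j : (\int[P]_om (a j om)%:E <= (4 * rad ^+ 2)%:E)%E.
  apply: (@le_trans _ _ (\int[P]_om (4 * rad ^+ 2)%:E)%E); last first.
    by rewrite integral_cst// [X in (_ * X)%E]probability_setT mule1.
  apply: ge0_le_integral => //; first by move=> om _; rewrite lee_fin.
    exact/measurable_EFinP.
  by move=> om _; rewrite lee_fin.
have Ia_ge0 j : (0 <= \int[P]_om (a j om)%:E)%E.
  by apply: integral_ge0 => om _; rewrite lee_fin.
have alE j : (\int[P]_om (a j om)%:E = (al j)%:E)%E.
  rewrite /al fineK// ge0_fin_numE//; apply: le_lt_trans (Ia_le j) _; exact: ltry.
(* Only [k - 1] times count: the attack at the last time of the window does not reach the output. *)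
pose S j := \bigcap_(i in [set: 'I_(k - 1)]) xi (j * k + i)%N @^-1` [set false].
have mS j : measurable (S j).
  apply: fin_bigcap_measurable => [|i _]; first exact: finite_finset.
  by rewrite -[X in measurable X]setTI; exact: measurable_funPT.
have PS j : P (S j) = (1 - q)%:E.
  by rewrite (quiet_probability _ _ _ xi_bernoulli xi_indep) ?p_ge0// /q subKr.
have PSC j : P (~` S j) = q%:E.
  by rewrite probability_setC// PS -EFinB subKr.
(* The iterate is determined by the history, the window by the future inputs and [S'] by the future
   of [xi]. *)
have trip j S' : sigma_future xi (j * k) S' ->
  forall Y Y', measurable Y -> measurable Y' ->
  (P (S' `&` (V j @^-1` Y `&` Dl j @^-1` Y')) =
   P S' * (P (V j @^-1` Y) * P (Dl j @^-1` Y')))%E.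
  move=> S'xi Y Y' mY mY'.
  apply: (independent_triple (indep (j * k)%N)) => //; first exact: window_future.
  rewrite (_ : Dl j @^-1` Y' = G (j * k)%N @^-1` ((fun M => M - Gstar) @^-1` Y'))//.
  apply: (@iterate_history _ _ _ _ _ _ _ A B C D x w u y xE yE rad gamma G g
    rad_ge0 G_init g_measurable G_step k_gt0).
  rewrite -[X in measurable X]setTI.
  have : measurable_fun setT (fun M : 'M[R]_(r, \sum_(j < k) m) => M - Gstar).
    exact: measurable_mxB.
  exact.
(* Error and window are integrated separately, so one number serves for every event of the future of
   [xi]. *)
pose W j : \bar R := (\int[distribution P (Dl j)]_M \int[distribution P (V j)]_v
  (norm2 (M *m v))%:E)%E.
have gapE j S' : measurable S' -> sigma_future xi (j * k) S' ->
  (\int[P]_(om in S') (norm2 (Dl j om *m V j om))%:E = P S' * W j)%E.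
  by move=> mS' S'xi; apply: gap_integral => //; exact: trip.
have kt j : (k <= (j * k + k - 1).+1)%N.
  by rewrite subn1 prednK ?leq_addl// addn_gt0 k_gt0 orbT.
have V2 j : (\int[P]_om (norm2 (V j om) ^+ 2)%:E <= ((m * k)%:R * sigma ^+ 2)%:E)%E.
  exact: (window_second_moment sigma_gt0 u_gaussian (U := V j) (t := (j * k + k - 1)%N)).
have mVn j : measurable_fun setT (fun om => norm2 (V j om)) by exact: measurable_norm2.
have mk_gt0 : 0 < (m * k)%:R :> R by rewrite ltr0n muln_gt0 m_gt0.
have V1 j : (\int[P]_om (norm2 (V j om))%:E <= (Num.sqrt (m * k)%:R * sigma)%:E)%E.
  apply: mean_le_of_second_moment => //.
  - by move=> om; exact: norm2_ge0.
  - by rewrite mulr_gt0// sqrtr_gt0.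
  - by rewrite exprMn sqr_sqrtr// ltW.
have mh j : measurable_fun setT (fun om => norm2 (Dl j om *m V j om)).
  by apply: measurable_norm2; exact: measurable_mulmx.
have W_ge0 j : (0 <= W j)%E.
  by apply: integral_ge0 => M _; apply: integral_ge0 => v _; rewrite lee_fin norm2_ge0.
have W_fin j : W j = (fine (W j))%:E.
  rewrite fineK// ge0_fin_numE//.
  have xiT : sigma_future xi (j * k) setT by exact: sigma_algebra_generatedT.
  have := gapE j setT measurableT xiT.
  rewrite [X in (_ = X * _)%E]probability_setT mul1e => <-.
  apply: (@le_lt_trans _ _ (\int[P]_om ((2 * rad)%:E * (norm2 (V j om))%:E))%E).
    apply: ge0_le_integral => //.
    - by move=> om _; rewrite lee_fin norm2_ge0.
    - exact/measurable_EFinP.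
    - by apply: emeasurable_funM => //; exact/measurable_EFinP.
    move=> om _; rewrite -EFinM lee_fin; apply: le_trans (norm2_mulmx _ _) _.
    by rewrite ler_wpM2r ?norm2_ge0.
  rewrite ge0_integralZl//; last 3 first.
  - exact/measurable_EFinP.
  - by move=> om _; rewrite lee_fin norm2_ge0.
  - by rewrite lee_fin mulr_ge0.
  apply: le_lt_trans (lee_wpmul2l _ (V1 j)) _; first by rewrite lee_fin mulr_ge0.
  by rewrite -EFinM ltry.
have W_ge j : sigma / Num.sqrt (2 * pi) / (2 * rad) * al j <= fine (W j).
  rewrite -lee_fin -W_fin EFinM -alE; apply: gap_ge => //.
  - by rewrite divr_gt0.
  - by rewrite mulr_gt0.
  move=> M.
  exact: (window_norm_moment_ge sigma_gt0 u_indep u_gaussian (kt j) (U := V j)).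
(* The step size at time [j * k], where the factor [k] cancels. *)
pose ga j := beta / j.+1%:R.
have gaE j : gamma (j * k)%N = ga j.
  rewrite /gamma /ga addnC -mulSn natrM.
  have k0 : k%:R != 0 :> R by rewrite pnatr_eq0 -lt0n.
  have : j.+1%:R != 0 :> R by rewrite pnatr_eq0.
  by move: (j.+1%:R : R) => J J0; field; rewrite J0 k0.
have ga_ge0 j : 0 <= ga j by rewrite divr_ge0// ltW.
pose z j om := C *m (A ^+ (k - 1) *m x (j * k)%N om).
(* [b] gathers the state remainder and the squared subgradient bound; the 4 is the 2 of the expanded
   square times the 2 of [excess_loss_quiet]. *)
pose b j om := 4 * ga j * norm2 (z j om) + ga j ^+ 2 * norm2 (V j om) ^+ 2.
have mz j : measurable_fun setT (fun om => norm2 (z j om)).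
  by apply: measurable_norm2; do 2 apply: measurable_mulmx => //.
have mb j : measurable_fun setT (b j).
  by apply: measurable_funD; apply: measurable_funM => //; exact: measurable_funX.
have b_ge0 j om : 0 <= b j om.
  by rewrite addr_ge0// mulr_ge0 ?sqr_ge0 ?norm2_ge0// mulr_ge0.
have Ib j : (\int[P]_om (b j om)%:E <=
    (4 * ga j * Z + ga j ^+ 2 * ((m * k)%:R * sigma ^+ 2))%:E)%E.
  have c1 : (0 <= (4 * ga j)%:E)%E by rewrite lee_fin mulr_ge0.
  have c2 : (0 <= (ga j ^+ 2)%:E)%E by rewrite lee_fin sqr_ge0.
  have mz' : measurable_fun setT (fun om => (norm2 (z j om))%:E) by exact/measurable_EFinP.
  have mV' : measurable_fun setT (fun om => (norm2 (V j om) ^+ 2)%:E).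
    by apply/measurable_EFinP; exact: measurable_funX.
  have z0 om : (0 <= (norm2 (z j om))%:E)%E by rewrite lee_fin norm2_ge0.
  have V0 om : (0 <= (norm2 (V j om) ^+ 2)%:E)%E by rewrite lee_fin sqr_ge0.
  rewrite (_ : (\int[P]_om _)%E = (\int[P]_om ((4 * ga j)%:E * (norm2 (z j om))%:E +
    (ga j ^+ 2)%:E * (norm2 (V j om) ^+ 2)%:E))%E); last first.
    by apply: eq_integral => om _; rewrite -!EFinM -EFinD.
  rewrite ge0_integralD//; [|by move=> om _; rewrite mule_ge0
    |exact: emeasurable_funM|by move=> om _; rewrite mule_ge0|exact: emeasurable_funM].
  rewrite !ge0_integralZl// EFinD [X in (_ <= X + _)%E]EFinM [X in (_ <= _ + X)%E]EFinM.
  by apply: leeD; apply: lee_wpmul2l => //; exact: z_mean.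
pose v j om := C *m (\sum_(i < k - 1) A ^+ (k - 1 - i.+1) *m w (j * k + i)%N om).
have decomp j om : y (j * k + k - 1)%N om - Gstar *m V j om = z j om + v j om.
  exact: (output_decomposition xE yE (j * k)%N om k_gt0).
have v0 j om : S j om -> v j om = 0.
  move=> Som; rewrite /v big1 ?mulmx0// => i _.
  by rewrite (_ : w _ om = 0) ?mulmx0//; apply: xi_w; exact: (Som i I).
have subgrad j om : a j.+1 om <= a j om -
    2 * ga j * (norm2 (y (j * k + k - 1)%N om - G (j * k)%N om *m V j om) -
                norm2 (y (j * k + k - 1)%N om - Gstar *m V j om)) +
    ga j ^+ 2 * norm2 (V j om) ^+ 2.
  have Gj : is_frob_projection (frob_ball rad) (G (j * k)%N om - ga j *: g (j * k)%N om)
      (G (j.+1 * k)%N om).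
    by rewrite -gaE mulSn addnC; exact: G_step.
  exact: (projected_subgradient_step rad_ge0 (ga_ge0 j) Gstar_le (g_subgrad _ (kdvd j) om) Gj).
have quiet_gap j om : S j om -> norm2 (Dl j om *m V j om) - 2 * norm2 (z j om) <=
    norm2 (y (j * k + k - 1)%N om - G (j * k)%N om *m V j om) -
    norm2 (y (j * k + k - 1)%N om - Gstar *m V j om).
  by move=> Som; exact: (excess_loss_quiet (G (j * k)%N om) (decomp j om) (v0 j om Som)).
have attacked_gap j om : - norm2 (Dl j om *m V j om) <=
    norm2 (y (j * k + k - 1)%N om - G (j * k)%N om *m V j om) -
    norm2 (y (j * k + k - 1)%N om - Gstar *m V j om).
  exact: (excess_loss_attacked (G (j * k)%N om) (decomp j om)).
have Sxi j : sigma_future xi (j * k) (S j) by exact: quiet_future.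
have IS j : (\int[P]_(om in S j) (norm2 (Dl j om *m V j om))%:E =
    ((1 - q) * fine (W j))%:E)%E.
  by rewrite (gapE j _ (mS j) (Sxi j)) PS W_fin.
have ISC j : (\int[P]_(om in ~` S j) (norm2 (Dl j om *m V j om))%:E =
    (q * fine (W j))%:E)%E.
  by rewrite (gapE j _ (measurableC (mS j)) (sigma_algebraC (Sxi j))) PSC W_fin.
have step j : al j.+1 <= al j - 2 * ga j * s * fine (W j) +
    (4 * ga j * Z + ga j ^+ 2 * ((m * k)%:R * sigma ^+ 2)).
  rewrite -lee_fin -alE.
  apply: (@expected_step _ _ _ P (S j) (a j.+1) (a j)
    (fun om => norm2 (Dl j om *m V j om)) (b j) (2 * ga j) q) => //.
  - by move=> om; exact: norm2_ge0.
  - by rewrite mulr_ge0.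
  - move=> om Som; exact: (quiet_step_bound (ga_ge0 j) (subgrad j om) (quiet_gap j om Som)).
  - move=> om _; exact: (attacked_step_bound (ga_ge0 j) (norm2_ge0 _) (subgrad j om)
      (attacked_gap j om)).
(* [2 ga s] times the coefficient in [W_ge] equals [c / (j + 1)]. *)
pose c := beta * s * sigma / (Num.sqrt (2 * pi) * rad).
have c1 : 1 < c by exact: contraction_gt1.
pose M := beta ^+ 2 * sigma ^+ 2 * (m * k)%:R.
(* The stationary level [4 beta Z / c] of the recursion, as [biasE] verifies. *)
pose bias := 8 * psi ^+ 2 * Num.sqrt (2 * pi) * rad * (rho ^+ (k - 1) * nu / (1 - rho)).
have EM : M / (c - 1) <= E by rewrite /E le_max lexx orbT.
have E_ge0 : 0 <= E.
  apply: le_trans EM; rewrite divr_ge0 ?subr_ge0 ?(ltW c1)// /M.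
  by apply: mulr_ge0; [apply: mulr_ge0; exact: sqr_ge0|exact: ltW].
have nu_ge0 : 0 <= nu.
  rewrite /nu -/s mulr_ge0 ?divr_ge0 ?(ltW s_gt0)//.
  rewrite addr_ge0// ?divr_ge0 ?(ltW eta_gt0) ?(ltW sigma_gt0)//.
  by rewrite mulr_ge0// sqrtr_ge0.
pose bb := rho ^+ (k - 1) * nu / (1 - rho).
have bb_ge0 : 0 <= bb.
  by apply: divr_ge0; [apply: mulr_ge0 => //; exact: exprn_ge0|exact: ltW].
have bias_ge0 : 0 <= bias.
  rewrite /bias -/bb; apply: mulr_ge0 => //; apply: mulr_ge0 => //.
  by apply: mulr_ge0; [apply: mulr_ge0 => //; exact: sqr_ge0|exact: ltW].
have biasE : c * bias = 4 * beta * Z.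
  rewrite /c /bias /Z /nu -/s; field.
  by rewrite !gt_eqF.
have rate : forall j, al j <= bias + E / j.+1%:R.
  apply: (@robbins_monro_rate R c M E (4 * rad ^+ 2) bias al c1 bias_ge0 E_ge0).
  - by rewrite -ler_pdivrMr// subr_gt0.
  - rewrite -lee_fin -alE.
    rewrite (_ : (\int[P]_om _)%E = (\int[P]_om (frob_norm (G0 - Gstar) ^+ 2)%:E)%E).
      by rewrite integral_cst// [X in (_ * X)%E]probability_setT mule1 lee_fin /E le_max lexx.
    by apply: eq_integral => om _; rewrite /a /Dl/= mul0n G_init.
  - by move=> j; rewrite -lee_fin -alE.
  - move=> j jc.
    apply: (diameter_le rad_gt0 sigma_gt0 s_gt0 s_le1 beta_gt (l := (m * k)%N)) EM jc.
    by rewrite (leq_trans k_ge2)// leq_pmull.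
  - move=> j; apply: le_trans (step j) _.
    have kaE : 2 * ga j * s * (sigma / Num.sqrt (2 * pi) / (2 * rad) * al j) =
        c / j.+1%:R * al j.
      have J0 : j.+1%:R != 0 :> R by rewrite pnatr_eq0.
      rewrite /ga /c; move: (j.+1%:R : R) J0 => J J0; field.
      by rewrite J0 !gt_eqF.
    have gs0 : 0 <= 2 * ga j * s by rewrite mulr_ge0 ?(ltW s_gt0)// mulr_ge0.
    have := ler_wpM2l gs0 (W_ge j); rewrite kaE => HW.
    have -> : c / j.+1%:R * bias = 4 * ga j * Z.
      by rewrite mulrAC biasE /ga; ring.
    have -> : M / j.+1%:R ^+ 2 = ga j ^+ 2 * ((m * k)%:R * sigma ^+ 2).
      by rewrite /M /ga exprMn exprVn; ring.
    by rewrite mulrBl mul1r -[leRHS]addrA lerD2r lerD2l lerN2.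
move=> t /dvdnP[j ->]; rewrite unlock.
rewrite (_ : (\int[P]_om _)%E = (al j)%:E) ?lee_fin; last exact: alE.
apply: le_trans (rate j) _.
rewrite -/bb mulrDr; apply: lerD; last first.
  have -> : k%:R * E / (j * k + k)%:R = E / j.+1%:R.
    rewrite addnC -mulSn natrM.
    have k0 : k%:R != 0 :> R by rewrite pnatr_eq0 -lt0n.
    have : j.+1%:R != 0 :> R by rewrite pnatr_eq0.
    by move: (j.+1%:R : R) => J J0; field; rewrite J0 k0.
  rewrite ler_peMl ?divr_ge0// lerDl.
  by apply: mulr_ge0; [apply: mulr_ge0 => //; exact: sqr_ge0|exact: ltW].
rewrite /bias -/bb -[leLHS]mulrA [rad * bb]mulrC.
apply: ler_pM.
- by apply: mulr_ge0; [apply: mulr_ge0 => //; exact: sqr_ge0|exact: ltW].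
- exact: mulr_ge0.
- by rewrite lerDr.
(* The nonnegative [bb] is dropped, and [rad <= rad sqrt (m k) / s] because [m k >= 1] and
   [s <= 1]. *)
rewrite ler_wpM2l// -/s (le_trans _ (lerD (lexx _) bb_ge0))// addr0 -mulrA ler_peMr//.
rewrite -[leLHS]mulr1; apply: ler_pM => //.
  by rewrite -[leLHS]sqrtr1 ler_sqrt ?ler0n// ler1n muln_gt0 m_gt0.
by rewrite invf_ge1.
Qed.
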